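(* Let $n\geq 3$, let $K^n_\omega$ be a weighted $n$-clique, and let $A$ be a field. Then the ideal $I_{2}(K^n_\omega)$ is Cohen-Macaulay if and only if every induced weighted sub-3-clique $K^3_{\omega'}$ of $K^n_\omega$ has $I_{2}(K^{3}_{\omega'})$ Cohen-Macaulay.
   Context: $\mathbb{N}=\{1,2,\dots\}$. A weighted $n$-clique $K^n_\omega$ is the complete graph $K^n$ on vertices $V=\{v_1,\dots,v_n\}$ together with a function $\omega$ assigning to each edge $v_iv_j$ a weight $\omega(v_iv_j)\in\mathbb{N}$. An induced weighted sub-3-clique is the subgraph induced by three distinct vertices, with the restricted weights $\omega'$. For a weighted graph $G_\omega$ (finite, simple) with vertices $v_i$ corresponding to polynomial variables $X_i$ over $A$, a 2-path is a sequence $v_iv_jv_k$ of distinct vertices with $v_iv_j$ and $v_jv_k$ edges, and the weighted 2-path ideal $I_2(G_\omega)$ is the ideal of the polynomial ring over $A$ in the variables corresponding to the vertices of $G$ generated by the monomials $$X_i^{\omega(v_iv_j)}X_j^{\max\{\omega(v_iv_j),\omega(v_jv_k)\}}X_k^{\omega(v_jv_k)}$$ for all 2-paths $v_iv_jv_k$ in $G$. So $I_2(K^n_\omega)$ is an ideal of $A[X_1,\dots,X_n]$, and $I_2(K^3_{\omega'})$ is an ideal of the polynomial ring in the three corresponding variables. An ideal $I$ of a polynomial ring $S$ is called Cohen-Macaulay when $S/I$ is a Cohen-Macaulay ring. *)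

(* Defs.v *)
From HB Require Import structures.
From mathcomp Require Import all_boot all_order all_algebra.
From mathcomp Require Import generic_quotient ring_quotient.
From mathcomp Require Import boolp.
From mathcomp Require Import mpoly ring.

Set Implicit Arguments.
Unset Strict Implicit.
Unset Printing Implicit Defensive.

Import GRing.Theory.
Local Open Scope ring_scope.
Local Open Scope quotient_scope.

Section Ideals.
Variable R : comNzRingType.

Definition ideal_span (G : R -> Prop) (x : R) : Prop :=
  exists2 s : seq (R * R),
    (forall c, c \in s -> G c.2) & x = \sum_(c <- s) c.1 * c.2.

(* [idealr_closed] only accepts proper ideals; the unit ideal being
   generated by 1, nothing is lost. *)
Definition noetherian : Prop :=
  forall I : {pred R}, idealr_closed I ->
  exists s : seq R, forall x, x \in I <-> ideal_span (fun y => y \in s) x.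

Definition prime_ideal (P : {pred R}) : Prop :=
  idealr_closed P /\ prime_idealr_closed P.

Definition maximal_ideal (M : {pred R}) : Prop :=
  idealr_closed M /\
  forall J : {pred R}, idealr_closed J -> {subset M <= J} -> J =i M.

Definition prime_chain (d : nat) (P : 'I_d.+1 -> {pred R}) : Prop :=
  (forall i, prime_ideal (P i)) /\
  (forall i j : 'I_d.+1, (i < j)%N ->
     {subset P i <= P j} /\ exists2 x, x \in P j & x \notin P i).

Definition krull_dim (d : nat) : Prop :=
  (exists P : 'I_d.+1 -> {pred R}, prime_chain P) /\
  (forall e (P : 'I_e.+1 -> {pred R}), prime_chain P -> (e <= d)%N).

(* The i-th element is a nonzerodivisor modulo the preceding ones, and the
   quotient by the whole sequence is nonzero. *)
Definition regular_seq (s : seq R) : Prop :=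
  (forall i, (i < size s)%N -> forall x,
     ideal_span (fun y => y \in take i s) (nth 0 s i * x) ->
     ideal_span (fun y => y \in take i s) x) /\
  ~ ideal_span (fun y => y \in s) 1.

Definition depth (M : {pred R}) (d : nat) : Prop :=
  (exists s, [/\ {subset s <= M}, regular_seq s & size s = d]) /\
  (forall s, {subset s <= M} -> regular_seq s -> (size s <= d)%N).

Definition local_ring (M : {pred R}) : Prop :=
  maximal_ideal M /\ forall M' : {pred R}, maximal_ideal M' -> M' =i M.

Definition cohen_macaulay_local : Prop :=
  exists M : {pred R}, local_ring M /\ exists d, krull_dim d /\ depth M d.

Lemma ideal_span0 G : ideal_span G 0.
Proof. by exists [::] => //; rewrite big_nil. Qed.

Lemma ideal_span_lin G a x y :
  ideal_span G x -> ideal_span G y -> ideal_span G (a * x + y).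
Proof.
case=> s Gs ->; case=> t Gt ->.
exists ([seq (a * c.1, c.2) | c <- s] ++ t).
  move=> c; rewrite mem_cat => /orP[/mapP[c' c's ->]|]; last exact: Gt.
  by move=> /=; exact: Gs.
rewrite big_cat big_map mulr_sumr; congr (_ + _).
by apply: eq_bigr => c _; rewrite mulrA.
Qed.

End Ideals.

Module Localization.
Section Localization.
Variables (R : comNzRingType) (P : prime_idealr R).

Definition frac := {x : R * R | x.2 \notin P}.
#[export]
HB.instance Definition _ := Choice.on frac.

Definition num (x : frac) : R := (val x).1.
Definition den (x : frac) : R := (val x).2.

Lemma denP (x : frac) : den x \notin P. Proof. exact: (valP x). Qed.

Lemma one_notin : 1 \notin P. Proof. by rewrite idealr1. Qed.

Lemma mul_notin u v : u \notin P -> v \notin P -> u * v \notin P.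
Proof. by move=> uP vP; rewrite prime_idealrM negb_or uP vP. Qed.

Definition Frac (a s : R) (sP : s \notin P) : frac :=
  exist (fun x : R * R => x.2 \notin P) (a, s) sP.

Definition eqf (x y : frac) : bool :=
  `[< exists2 u, u \notin P & u * (num x * den y) = u * (num y * den x) >].

Lemma eqf_is_equiv : equiv_class_of eqf.
Proof.
have trans x y z : eqf x y -> eqf y z -> eqf x z.
  move=> /asboolP[u uP e1] /asboolP[v vP e2]; apply/asboolP.
  exists (u * v * den y); first by rewrite !mul_notin ?denP.
  have -> : u * v * den y * (num x * den z)
          = v * den z * (u * (num x * den y)) by ring.
  have -> : u * v * den y * (num z * den x)
          = u * den x * (v * (num z * den y)) by ring.
  by rewrite e1 -e2; ring.
have sym x y : eqf x y -> eqf y x.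
  by move=> /asboolP[u uP e]; apply/asboolP; exists u.
split=> [x|x y|y x z].
- by apply/asboolP; exists 1; first exact: one_notin.
- by apply/idP/idP; apply: sym.
- exact: trans.
Qed.

Canonical eqf_equiv := EquivRelPack eqf_is_equiv.
Canonical eqf_encModRel := defaultEncModRel eqf.

Definition loc := {eq_quot eqf}.
#[export]
HB.instance Definition _ : EqQuotient _ eqf loc := EqQuotient.on loc.
#[export]
HB.instance Definition _ := Choice.on loc.

Definition addf (x y : frac) : frac :=
  Frac (num x * den y + num y * den x) (mul_notin (denP x) (denP y)).
Definition oppf (x : frac) : frac := Frac (- num x) (denP x).
Definition mulf (x y : frac) : frac :=
  Frac (num x * num y) (mul_notin (denP x) (denP y)).
Definition ofR (a : R) : frac := Frac a one_notin.

Definition add := lift_op2 loc addf.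
Definition opp := lift_op1 loc oppf.
Definition mul := lift_op2 loc mulf.
Definition zero : loc := lift_cst loc (ofR 0).
Definition one : loc := lift_cst loc (ofR 1).

Lemma piP (x y : frac) :
  reflect (exists2 u, u \notin P & u * (num x * den y) = u * (num y * den x))
          (x == y %[mod loc]).
Proof. by rewrite piE; apply: asboolP. Qed.

Lemma reprP (x : frac) : exists2 u, u \notin P &
  u * (num (repr (\pi_loc x)) * den x) = u * (num x * den (repr (\pi_loc x))).
Proof. by apply/piP; rewrite reprK. Qed.

Lemma pi_add : {morph \pi_loc : x y / addf x y >-> add x y}.
Proof.
move=> x y; unlock add; apply/eqP; rewrite eq_sym; apply/piP.
have [u uP eu] := reprP x; have [v vP ev] := reprP y.
exists (u * v); first exact: mul_notin.
rewrite /addf /num /den /= -!/(num _) -!/(den _).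
move: (repr (\pi_loc x)) (repr (\pi_loc y)) eu ev => x' y' eu ev.
transitivity (v * (den y * den y') * (u * (num x' * den x))
            + u * (den x * den x') * (v * (num y' * den y))); first by ring.
by rewrite eu ev; ring.
Qed.
Canonical pi_add_morph := PiMorph2 pi_add.

Lemma pi_opp : {morph \pi_loc : x / oppf x >-> opp x}.
Proof.
move=> x; unlock opp; apply/eqP; rewrite eq_sym; apply/piP.
have [u uP eu] := reprP x; exists u => //.
rewrite /oppf /num /den /= -!/(num _) -!/(den _).
by rewrite !mulNr !mulrN eu.
Qed.
Canonical pi_opp_morph := PiMorph1 pi_opp.

Lemma pi_mul : {morph \pi_loc : x y / mulf x y >-> mul x y}.
Proof.
move=> x y; unlock mul; apply/eqP; rewrite eq_sym; apply/piP.
have [u uP eu] := reprP x; have [v vP ev] := reprP y.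
exists (u * v); first exact: mul_notin.
rewrite /mulf /num /den /= -!/(num _) -!/(den _).
move: (repr (\pi_loc x)) (repr (\pi_loc y)) eu ev => x' y' eu ev.
transitivity ((u * (num x' * den x)) * (v * (num y' * den y))); first by ring.
by rewrite eu ev; ring.
Qed.
Canonical pi_mul_morph := PiMorph2 pi_mul.

Canonical pi_zero_morph := PiConst zero.
Canonical pi_one_morph := PiConst one.

Lemma eq_pi (x y : frac) : num x * den y = num y * den x -> \pi_loc x = \pi y.
Proof. by move=> e; apply/eqP/piP; exists 1; [exact: one_notin | rewrite e]. Qed.

Lemma addA : associative add.
Proof.
elim/quotW=> x; elim/quotW=> y; elim/quotW=> z; rewrite !piE.
by apply: eq_pi; rewrite /addf /num /den /=; ring.
Qed.

Lemma addC : commutative add.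
Proof.
elim/quotW=> x; elim/quotW=> y; rewrite !piE.
by apply: eq_pi; rewrite /addf /num /den /=; ring.
Qed.

Lemma add0 : left_id zero add.
Proof.
elim/quotW=> x; rewrite !piE.
by apply: eq_pi; rewrite /addf /num /den /=; ring.
Qed.

Lemma addN : left_inverse zero opp add.
Proof.
elim/quotW=> x; rewrite !piE.
by apply: eq_pi; rewrite /addf /oppf /num /den /=; ring.
Qed.

#[export]
HB.instance Definition _ := GRing.isZmodule.Build loc addA addC add0 addN.

Lemma mulA : associative mul.
Proof.
elim/quotW=> x; elim/quotW=> y; elim/quotW=> z; rewrite !piE.
by apply: eq_pi; rewrite /mulf /num /den /=; ring.
Qed.

Lemma mulC : commutative mul.
Proof.
elim/quotW=> x; elim/quotW=> y; rewrite !piE.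
by apply: eq_pi; rewrite /mulf /num /den /=; ring.
Qed.

Lemma mul1 : left_id one mul.
Proof.
elim/quotW=> x; rewrite !piE.
by apply: eq_pi; rewrite /mulf /num /den /=; ring.
Qed.

Lemma mulDl : left_distributive mul add.
Proof.
elim/quotW=> x; elim/quotW=> y; elim/quotW=> z; rewrite !piE.
by apply: eq_pi; rewrite /mulf /addf /num /den /=; ring.
Qed.

Lemma one_neq0 : one != zero.
Proof.
rewrite !piE; apply/asboolP => -[u uP]; rewrite /num /den /=.
by rewrite !mulr1 mulr0 => u0; case/negP: uP; rewrite u0 idealr0.
Qed.

#[export]
HB.instance Definition _ :=
  GRing.Zmodule_isComNzRing.Build loc mulA mulC mul1 mulDl one_neq0.

End Localization.

Module Exports. HB.reexport. End Exports.
End Localization.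
Export Localization.Exports.

Notation localization P := (Localization.loc P).

Definition cohen_macaulay (R : comNzRingType) : Prop :=
  noetherian R /\
  forall M : prime_idealr R, maximal_ideal M ->
    cohen_macaulay_local (localization M).

Definition cohen_macaulay_ideal (R : comNzRingType) (I : idealr R) : Prop :=
  cohen_macaulay {ideal_quot I}.

(* The value of [weight] on non-edges is irrelevant. *)
Record wgraph (n : nat) := WGraph {
  edge : rel 'I_n;
  weight : 'I_n -> 'I_n -> nat;
  edge_sym : ssrbool.symmetric edge;
  edge_irr : irreflexive edge;
  weight_sym : forall i j, edge i j -> weight i j = weight j i;
  weight_gt0 : forall i j, edge i j -> (0 < weight i j)%N
}.

Definition is_clique (n : nat) (G : wgraph n) : Prop :=
  forall i j, i != j -> edge G i j.

(* The vertices of W are relabelled by 'I_#|W| in increasing order. *)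
Definition induced (n : nat) (G : wgraph n) (W : {set 'I_n}) : wgraph #|W| :=
  @WGraph #|W|
    (fun i j => edge G (enum_val i) (enum_val j))
    (fun i j => weight G (enum_val i) (enum_val j))
    (fun i j => edge_sym G (enum_val i) (enum_val j))
    (fun i => edge_irr G (enum_val i))
    (fun i j => @weight_sym n G (enum_val i) (enum_val j))
    (fun i j => @weight_gt0 n G (enum_val i) (enum_val j)).

Section PathIdeal.
Variables (A : comNzRingType) (n : nat) (G : wgraph n).

Definition path2 (i j k : 'I_n) : Prop :=
  [/\ i != j, j != k, i != k, edge G i j & edge G j k].

Definition path2_gen (p : {mpoly A[n]}) : Prop :=
  exists i j k, path2 i j k /\
    p = 'X_i ^+ weight G i j
        * 'X_j ^+ maxn (weight G i j) (weight G j k)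
        * 'X_k ^+ weight G j k.

Definition path2_ideal : {pred {mpoly A[n]}} :=
  fun p => `[< ideal_span path2_gen p >].

Lemma path2_ideal_closed : idealr_closed path2_ideal.
Proof.
split; first by apply/asboolP; exact: ideal_span0.
- apply/asboolP => -[s sG e1].
  have: (1 : {mpoly A[n]}).@[fun=> 0] = 0.
    rewrite e1 raddf_sum big_seq big1 // => c /sG[i [j [k [[_ _ _ ij _] ->]]]].
    rewrite /= !mevalM !rmorphXn /= !mevalXU.
    by rewrite !expr0n -[weight G i j]prednK ?weight_gt0 //= !(mul0r, mulr0).
  by rewrite meval1 => /eqP; rewrite oner_eq0.
- move=> a u v /asboolP su /asboolP sv; apply/asboolP.
  exact: ideal_span_lin.
Qed.

HB.instance Definition _ :=
  isIdealr.Build {mpoly A[n]} path2_ideal path2_ideal_closed.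

End PathIdeal.

Definition I2 (A : comNzRingType) (n : nat) (G : wgraph n) :
  idealr ({mpoly A[n]} : comNzRingType) := path2_ideal G.

Arguments I2 A {n} G.

(* Main.v *)
Require Import Defs.
From mathcomp Require Import all_boot all_order all_algebra.
From HB Require Import structures.
From mathcomp Require Import generic_quotient ring_quotient.
From mathcomp Require Import boolp.
From mathcomp Require Import mpoly ring zify.

(* Both sides are equivalent to the weights being a reversed ultrametric: in every
   triangle the smallest weight occurs at least twice.

   If a triangle v1 v2 l has w(v1 v2) = a < w(v1 l), w(v2 l), put e = (X_v1 X_v2)^a.
   Products of a high power of X_v1 or X_v2 with a high power of another variable
   kill e modulo I, although neither kind of power kills it alone.  At the origin the
   quotient has dimension at least 2; a regular pair there would let one glue e (near
   X_v1, X_v2) with 0 (elsewhere) to a global element, which the monomial grading forbids.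

   Conversely, for ultrametric weights I is the intersection of the ideals
   I_pq = (X_k^min(w_pk, w_qk) : k <> p, q), and a monomial lying outside several I_pq
   links the corresponding edges pq through shared vertices.  Let M be maximal.  Since
   every X_k is algebraic modulo M, there are nonzero u_k with u_k(0) = 0 and
   u_k(X_k) in M; then f = sum u_k(X_k), g = sum_(i < j) u_i(X_i) u_j(X_j) is regular
   modulo each I_pq (reduce to u(x) + v(y), u(x) v(y) in A[x, y]), f is regular modulo
   I_pq + I_pr, and local quotients by f glue along shared vertices, so f, g is regular
   modulo I.  Dimension and depth are at most 2 because any three elements satisfy a
   polynomial relation modulo I, by counting monomials. *)

Set Implicit Arguments.
Unset Strict Implicit.
Unset Printing Implicit Defensive.

Import Order.Theory GRing.Theory.
Local Open Scope ring_scope.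
Local Open Scope quotient_scope.

(** * Ideal spans and the basis theorem *)

Section Spans.
Variable R : comNzRingType.
Implicit Types (G H : R -> Prop) (I : {pred R}) (x y : R).

Lemma span_gen G x : G x -> ideal_span G x.
Proof.
move=> Gx; exists [:: (1, x)]; last by rewrite big_seq1 mul1r.
by move=> c; rewrite inE => /eqP->.
Qed.

Lemma spanD G x y : ideal_span G x -> ideal_span G y -> ideal_span G (x + y).
Proof. by move=> Gx Gy; rewrite -[x]mul1r; apply: ideal_span_lin. Qed.

Lemma spanM G a x : ideal_span G x -> ideal_span G (a * x).
Proof. by move=> Gx; rewrite -[_ * _]addr0; apply: ideal_span_lin (ideal_span0 _). Qed.

Lemma span_sum G (J : Type) (s : seq J) (P : pred J) (F : J -> R) :
  (forall i, P i -> ideal_span G (F i)) -> ideal_span G (\sum_(i <- s | P i) F i).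
Proof.
move=> GF; elim/big_rec: _ => [|i x Pi Gx]; first exact: ideal_span0.
exact: spanD (GF i Pi) Gx.
Qed.

Lemma span_sub G H x : (forall y, G y -> ideal_span H y) -> ideal_span G x ->
  ideal_span H x.
Proof.
move=> GH [s Gs ->]; elim: s Gs => [|c s IHs] Gs.
  by rewrite big_nil; exact: ideal_span0.
rewrite big_cons; apply: ideal_span_lin; first by apply/GH/Gs/mem_head.
by apply: IHs => c' c's; apply: Gs; rewrite inE c's orbT.
Qed.

Lemma idealr_closed_span I x : idealr_closed I ->
  ideal_span (fun y => y \in I) x -> x \in I.
Proof.
case=> I0 _ Ilin [s sI ->]; elim: s sI => [|c s IHs] sI; first by rewrite big_nil.
rewrite big_cons; apply: Ilin; first by apply: sI; exact: mem_head.
by apply: IHs => c' c's; apply: sI; rewrite inE c's orbT.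
Qed.

Lemma span_nil x : ideal_span (fun y : R => y \in [::]) x -> x = 0.
Proof.
case=> [[|c s]] Gs ->; first by rewrite big_nil.
by have := Gs c (mem_head _ _).
Qed.

Lemma span_consP a (s : seq R) x :
  ideal_span (fun y => y \in a :: s) x <->
  exists b, ideal_span (fun y => y \in s) (x - b * a).
Proof.
split=> [[t Gt ->]|[b Gb]].
  elim: t Gt => [|c t IHt] Gt.
    by exists 0; rewrite big_nil mul0r subr0; exact: ideal_span0.
  have [|b Gb] := IHt; first by move=> d dt; apply: Gt; rewrite inE dt orbT.
  have := Gt c (mem_head _ _); rewrite inE => /orP[/eqP ca|cs].
    exists (c.1 + b); rewrite big_cons ca.
    suff -> : c.1 * a + \sum_(j <- t) j.1 * j.2 - (c.1 + b) * a =
      \sum_(j <- t) j.1 * j.2 - b * a by [].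
    by ring.
  exists b; rewrite big_cons -addrA; apply: ideal_span_lin => //.
  exact: span_gen.
rewrite -[x](subrK (b * a)); apply: spanD; last first.
  by apply/spanM/span_gen; exact: mem_head.
by apply: span_sub Gb => y ys; apply: span_gen; rewrite inE ys orbT.
Qed.

End Spans.

Section Noetherian.

Lemma noetherian_quot (R : comNzRingType) (I : idealr R) :
  noetherian R -> noetherian {ideal_quot I}.
Proof.
move=> noeR J idJ; have [J0 J1 Jlin] := idJ.
pose J' : {pred R} := fun x => \pi_({ideal_quot I}) x \in J.
have [|s sP] := noeR J'.
  split.
  - by rewrite unfold_in rmorph0.
  - by rewrite unfold_in rmorph1.
  - move=> a u v; rewrite !unfold_in rmorphD rmorphM; exact: Jlin.
exists (map \pi_({ideal_quot I}) s) => y; split.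
  rewrite -[y]reprK => Jy.
  have /sP[t ts et] : repr y \in J' by [].
  exists [seq (\pi_({ideal_quot I}) c.1, \pi_({ideal_quot I}) c.2) | c <- t].
    by move=> _ /mapP[c ct ->] /=; apply/map_f/ts.
  by rewrite et rmorph_sum big_map; apply: eq_bigr => c _; rewrite rmorphM.
move=> Gy; apply: idealr_closed_span => //; apply: span_sub Gy => _ /mapP[x xs ->].
by apply: span_gen; apply/(sP x)/span_gen.
Qed.

(** Repeatedly pick, past the previous index, a position where [f] is minimal on the remaining tail;
    every later value is then at least as large. *)
Lemma nondecreasing_subseq (f : nat -> nat) :
  exists g : nat -> nat, (forall i, g i < g i.+1)%N /\
    (forall i, f (g i) <= f (g i.+1))%N.
Proof.
have step k : {m | (k <= m)%N & forall l, (k <= l)%N -> (f m <= f l)%N}.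
  have ex : exists v, `[< exists2 m, (k <= m)%N & f m = v >].
    by exists (f k); apply/asboolP; exists k.
  have [v /asboolP exv vmin] := ex_minnP ex.
  have [m km fm] := cid2 exv.
  by exists m => // l kl; rewrite fm; apply/vmin/asboolP; exists l.
pose g := fix g i := if i is j.+1 then s2val (step (g j).+1) else s2val (step 0%N).
exists g; split=> i /=; first exact: (s2valP (step _)).
case: i => [|i] /=; first by apply: (s2valP' (step 0%N)).
apply: (s2valP' (step _)); apply: leq_trans (s2valP (step _)).
by apply: leq_trans (leqnSn _); exact: (s2valP (step _)).
Qed.

(** Pass to a nondecreasing subsequence for one coordinate after another; the first two terms of the
    last subsequence are comparable. *)
Lemma dickson n (f : nat -> 'X_{1..n}) : exists i j, (i < j)%N /\ (f i <= f j)%MM.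
Proof.
suff [g [gS fg]] : exists g : nat -> nat, (forall i, g i < g i.+1)%N /\
    forall k, k \in enum 'I_n -> forall i, (f (g i) k <= f (g i.+1) k)%N.
  exists (g 0%N), (g 1%N); split=> //; apply/mnm_lepP => k.
  by apply: fg; rewrite mem_enum.
elim: (enum 'I_n) => [|k s [g [gS fg]]]; first by exists id.
have [h [hS fh]] := nondecreasing_subseq (fun i => f (g i) k).
have gmono : {homo g : i j / (i < j)%N} := homo_ltn ltn_trans gS.
exists (g \o h); split=> [i|l]; first exact: gmono.
rewrite inE => /orP[/eqP-> //|ls] i /=.
have fmono : {homo (fun i => f (g i) l) : i j / (i <= j)%N}.
  exact: (homo_leq leqnn leq_trans (fg l ls)).
exact/fmono/ltnW.
Qed.

(** The Groebner basis argument: collect elements of [I] whose leading monomials are divisible by no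
    earlier one. This stops by Dickson's lemma, and division by leading terms then reduces every
    element of [I] to zero. *)
Lemma noetherian_mpoly (A : fieldType) n : noetherian {mpoly A[n]}.
Proof.
move=> I idI; have [I0 I1 Ilin] := idI.
pose good (s : seq {mpoly A[n]}) := forall q, q \in s -> q \in I /\ q != 0.
pose bad (s : seq {mpoly A[n]}) p := [/\ p \in I, p != 0 &
  forall q, q \in s -> ~~ (mlead q <= mlead p)%MM].
have [s [sI sdom]] : exists s, good s /\ forall p, ~ bad s p.
  apply: contrapT => nos.
  have next s : {p | good s -> bad s p}.
    apply: cid; apply: contrapT => nop; apply: nos; exists s; split.
      by apply: contrapT => nsI; apply: nop; exists 0.
    by move=> p bp; apply: nop; exists p.
  pose G := fix G i := if i is j.+1 then sval (next (G j)) :: G j else [::].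
  have GI i : good (G i).
    elim: i => //= i IHi p; rewrite inE => /orP[/eqP->|/IHi//].
    by have [] := svalP (next (G i)) IHi.
  have GG i j : (i < j)%N -> sval (next (G i)) \in G j.
    elim: j => // j IHj; rewrite ltnS leq_eqVlt => /orP[/eqP->|/IHj].
      exact: mem_head.
    by move=> h; rewrite inE h orbT.
  have [i [j [ij]]] := dickson (fun i => mlead (sval (next (G i)))).
  have [_ _ /(_ _ (GG _ _ ij))] := svalP (next (G j)) (@GI j).
  by move/negP.
exists s => p; split; last first.
  move=> Gp; apply: idealr_closed_span => //; apply: span_sub Gp => y ys.
  by apply: span_gen; have [] := sI y ys.
elim/mleadrect: p => p IHp pI; have [->|p0] := eqVneq p 0; first exact: ideal_span0.
have [q qs qp] : exists2 q, q \in s & (mlead q <= mlead p)%MM.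
  apply: contrapT => noq; apply: (sdom p); split=> // q qs; apply/negP => qp.
  by apply: noq; exists q.
have [qI q0] := sI q qs.
(* [t * q] has the same leading term as [p], so [p - t * q] is zero or has a smaller leading
   monomial. *)
pose t : {mpoly A[n]} := (p@_(mlead p) / q@_(mlead q)) *: 'X_[mlead p - mlead q].
have c0 : p@_(mlead p) / q@_(mlead q) != 0.
  by rewrite mulf_neq0 ?invr_eq0 ?mleadc_eq0.
have lt : mlead t = (mlead p - mlead q)%MM.
  by rewrite mleadZ_proper mleadXm // mcoeffX eqxx mulr1.
have ct : mleadc t * mleadc q = p@_(mlead p).
  by rewrite lt mcoeffZ mcoeffX eqxx mulr1 divfK ?mleadc_eq0.
have tq0 : mleadc t * mleadc q != 0 by rewrite ct mleadc_eq0.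
have ltq : mlead (t * q) = mlead p by rewrite mleadM_proper // lt submK.
have ctq : (t * q)@_(mlead p) = p@_(mlead p) by rewrite -ltq mleadcM_proper // ltq.
rewrite -[p](subrK (t * q)); apply: spanD; last exact/spanM/span_gen.
have [->|r0] := eqVneq (p - t * q) 0; first exact: ideal_span0.
apply: IHp; last first.
  by rewrite addrC -mulNr; apply: Ilin.
rewrite lt_neqAle; apply/andP; split; last first.
  by apply: le_trans (mleadB_le _ _) _; rewrite ltq joinxx.
by apply: contra r0 => /eqP e; rewrite -mleadc_eq0 e mcoeffB ctq subrr.
Qed.

End Noetherian.

(** * Localization *)

Section PrimeIdeals.
Variables (R : comNzRingType) (P : {pred R}).

Lemma idealrD (x y : R) : idealr_closed P -> x \in P -> y \in P -> x + y \in P.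
Proof. by case=> _ _ Plin xP yP; rewrite -[x]mul1r Plin. Qed.

Lemma idealrM (x y : R) : idealr_closed P -> y \in P -> x * y \in P.
Proof. by case=> P0 _ Plin yP; rewrite -[x * y]addr0 Plin. Qed.

Lemma idealrB (x y : R) : idealr_closed P -> x \in P -> y \in P -> x - y \in P.
Proof. by move=> idP xP yP; rewrite -mulN1r idealrD // idealrM. Qed.

Lemma idealr_sum (J : Type) (s : seq J) (Q : pred J) (F : J -> R) :
  idealr_closed P -> (forall i, Q i -> F i \in P) -> \sum_(i <- s | Q i) F i \in P.
Proof.
move=> idP PF; elim/big_ind: _ => //; first by case: idP.
by move=> x y; exact: idealrD.
Qed.

Lemma prime_idealM (x y : R) : prime_ideal P -> (x * y \in P) = (x \in P) || (y \in P).
Proof.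
case=> idlP prP; apply/idP/orP => [/prP/orP //|[xP|yP]]; last exact: idealrM.
by rewrite mulrC idealrM.
Qed.

Lemma prime_idealX (x : R) k : prime_ideal P -> x ^+ k \in P -> x \in P.
Proof.
move=> prP; elim: k => [|k IHk]; last by rewrite exprS prime_idealM // => /orP[].
by case: prP => -[_ /negP P1 _] _ /P1.
Qed.

End PrimeIdeals.

(* [psi] exhibits [T] as the localization of [S / I] at the prime [M / I]. *)
Record localizes (S T : comNzRingType) (I M : {pred S}) (psi : {rmorphism S -> T}) :
    Prop := Localizes {
  localizes_ideal : idealr_closed I;
  localizes_prime : prime_ideal M;
  localizes_sub : {subset I <= M};
  localizes_ker : forall x, psi x = 0 <-> exists2 s, s \notin M & s * x \in I;
  localizes_surj : forall t, exists2 s, s \notin M & exists x, psi s * t = psi x;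
  localizes_unit : forall s, s \notin M -> exists v, v * psi s = 1 }.

Section Localized.
Variables (S T : comNzRingType) (I M : {pred S}) (psi : {rmorphism S -> T}).
Hypothesis loc : localizes I M psi.
Implicit Types (P : {pred S}) (x y s : S) (t : T).

Let idI : idealr_closed I := localizes_ideal loc.
Let prM : prime_ideal M := localizes_prime loc.

Lemma notin_mul x y : x \notin M -> y \notin M -> x * y \notin M.
Proof. by rewrite prime_idealM // negb_or => -> ->. Qed.

Definition extended P : {pred T} :=
  fun t => `[< exists s x, [/\ s \notin M, x \in P & psi s * t = psi x] >].

Section Extended.
Variable P : {pred S}.
Hypotheses (prP : prime_ideal P) (IP : {subset I <= P}) (PM : {subset P <= M}).

Let idlP : idealr_closed P := prP.1.

(** An equality of fractions holds in [S] modulo [I] after multiplication by some element outside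
    [M]; such elements lie outside the prime [P] and cancel. *)
Lemma mem_extended x : (psi x \in extended P) = (x \in P).
Proof.
apply/asboolP/idP => [[s [y [sM yP e]]]|xP]; last first.
  by exists 1, x; rewrite rmorph1 mul1r; split=> //; case: prM => -[].
have /(localizes_ker loc)[s' s'M /IP] : psi (s * x - y) = 0.
  by rewrite rmorphB rmorphM e subrr.
have notP z : z \notin M -> (z \in P) = false by move=> zM; apply: contraNF zM => /PM.
rewrite prime_idealM // notP //= => sxP.
have : s * x \in P by rewrite -[s * x](subrK y) idealrD.
by rewrite prime_idealM // notP.
Qed.

Lemma extended_prime : prime_ideal (extended P).
Proof.
have ext1 : 1 \in extended P = false.
  by rewrite -(rmorph1 psi) mem_extended; apply: negbTE; case: idlP.
split; first split.
- by rewrite -(rmorph0 psi) mem_extended; case: idlP.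
- by rewrite ext1.
- move=> a u v /asboolP[s [x [sM xP eu]]] /asboolP[s' [y [s'M yP ev]]].
  have [b bM [c ea]] := localizes_surj loc a.
  apply/asboolP; exists (b * s * s'), (s' * c * x + b * s * y); split.
  + by rewrite !notin_mul.
  + by rewrite idealrD // idealrM.
  + rewrite rmorphD !rmorphM -eu -ev -ea; ring.
- move=> u v uvP.
  have [s sM [x eu]] := localizes_surj loc u; have [s' s'M [y ev]] := localizes_surj loc v.
  have : psi (x * y) \in extended P.
    rewrite rmorphM -eu -ev.
    have -> : psi s * u * (psi s' * v) = psi (s * s') * (u * v) by rewrite rmorphM; ring.
    case/asboolP: uvP => s'' [z [s''M zP e]]; apply/asboolP; exists s'', (s * s' * z).
    by split=> //; [rewrite idealrM | rewrite (rmorphM psi _ z) -e; ring].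
  rewrite mem_extended prime_idealM // => /orP[] h; apply/orP; [left|right]; apply/asboolP.
    by exists s, x.
  by exists s', y.
Qed.

End Extended.

Lemma sub_extended P Q : {subset P <= Q} -> {subset extended P <= extended Q}.
Proof.
by move=> PQ t /asboolP[s [x [sM xP e]]]; apply/asboolP; exists s, x; split=> //; exact: PQ.
Qed.

Lemma extended_chain d (P : 'I_d.+1 -> {pred S}) : prime_chain P ->
  (forall i, {subset I <= P i}) -> (forall i, {subset P i <= M}) ->
  prime_chain (extended \o P).
Proof.
case=> prP chP IP PM; split=> [i|i j ij] /=; first exact: extended_prime.
have [sub [x xj xi]] := chP i j ij; split; first exact: sub_extended.
by exists (psi x); rewrite mem_extended.
Qed.

Lemma notin_extended_unit t : t \notin extended M -> exists v, v * t = 1.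
Proof.
have [s sM [x e]] := localizes_surj loc t => tM.
have [|v ve] := localizes_unit loc (s := x).
  by apply: contra tM => xM; apply/asboolP; exists s, x.
by exists (v * psi s); rewrite -mulrA e.
Qed.

Lemma ideal_sub_extended (J : {pred T}) : idealr_closed J -> {subset J <= extended M}.
Proof.
move=> idJ t tJ; apply: contrapT => /negP /notin_extended_unit[v e].
by case: (idJ) => _ /negP[]; rewrite -e idealrM.
Qed.

Lemma extended_local : local_ring (extended M).
Proof.
have idM : idealr_closed (extended M).
  by have [] := extended_prime prM (localizes_sub loc) (fun _ => id).
split=> [|J [idJ maxJ] x]; first split=> // J idJ MJ x.
  by apply/idP/idP; [exact: ideal_sub_extended | exact: MJ].
by rewrite (maxJ _ idM) //; exact: ideal_sub_extended.
Qed.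

Lemma local_eq_extended (J : {pred T}) : local_ring J -> J =i extended M.
Proof. by case=> maxJ _ x; have [_ ->] := extended_local. Qed.

End Localized.

Section LocalizationMap.
Variables (R : comNzRingType) (P : prime_idealr R).

Definition to_loc (x : R) : localization P :=
  \pi_(localization P) (Localization.Frac x (Localization.one_notin P)).

Lemma to_loc_is_zmod_morphism : zmod_morphism to_loc.
Proof.
move=> x y; rewrite -[RHS]/(Localization.add (to_loc x) (Localization.opp (to_loc y))) /to_loc.
rewrite -Localization.pi_opp -Localization.pi_add; apply: Localization.eq_pi.
by rewrite /Localization.addf /Localization.oppf
  /Localization.mulf /Localization.num
  /Localization.den /=; ring.
Qed.

Lemma to_loc_is_monoid_morphism : monoid_morphism to_loc.
Proof.
split; first by rewrite -[RHS]/(Localization.one P); unlock Localization.one.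
move=> x y; rewrite -[RHS]/(Localization.mul (to_loc x) (to_loc y)) /to_loc -Localization.pi_mul.
by apply: Localization.eq_pi; rewrite /Localization.addf /Localization.oppf
  /Localization.mulf /Localization.num
  /Localization.den /=; ring.
Qed.

HB.instance Definition _ :=
  GRing.isZmodMorphism.Build R (localization P) to_loc to_loc_is_zmod_morphism.
HB.instance Definition _ :=
  GRing.isMonoidMorphism.Build R (localization P) to_loc to_loc_is_monoid_morphism.

Lemma to_loc_eq0 x : to_loc x = 0 <-> exists2 s, s \notin P & s * x = 0.
Proof.
rewrite -(rmorph0 to_loc); split=> [/eqP/Localization.piP[s sP]|[s sP e]].
  rewrite /Localization.num /Localization.den /= !mulr1 mulr0 => e.
  by exists s.
apply/eqP/Localization.piP; exists s => //.
by rewrite /Localization.num /Localization.den /= !mulr1 mulr0.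
Qed.

Lemma to_loc_surj t : exists2 s, s \notin P & exists x, to_loc s * t = to_loc x.
Proof.
elim/quotW: t => -[[x s] sP]; exists s => //; exists x.
rewrite /to_loc -[LHS]/(Localization.mul _ _) -Localization.pi_mul.
by apply: Localization.eq_pi; rewrite /Localization.addf /Localization.oppf
  /Localization.mulf /Localization.num
  /Localization.den /=; ring.
Qed.

Lemma to_loc_unit s : s \notin P -> exists v, v * to_loc s = 1.
Proof.
move=> sP; exists (\pi_(localization P) (Localization.Frac 1 sP)).
rewrite -(rmorph1 to_loc) /to_loc -[LHS]/(Localization.mul _ _) -Localization.pi_mul.
by apply: Localization.eq_pi; rewrite /Localization.addf /Localization.oppf
  /Localization.mulf /Localization.num
  /Localization.den /=; ring.
Qed.

End LocalizationMap.

Section QuotientLocalization.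
Variables (S : comNzRingType) (I : idealr S) (M : prime_idealr {ideal_quot I}).

Definition contracted : {pred S} := fun x => \pi_({ideal_quot I}) x \in M.

Lemma pi_ideal_eq0 x : (\pi_({ideal_quot I}) x = 0) <-> x \in I.
Proof.
rewrite -[x in x \in I]subr0 Quotient.idealrBE -(rmorph0 \pi_({ideal_quot I})).
by split=> [->|/eqP].
Qed.

(** This lets the local rings of the quotient be studied with polynomials: fractions over the
    quotient by [I] are lifted to [S] through [repr]. *)
Lemma localizes_quot :
  localizes I contracted (@to_loc _ M \o \pi_({ideal_quot I})).
Proof.
have mem x : (x \in contracted) = (\pi_({ideal_quot I}) x \in M) by [].
split.
- split; [exact: idealr0 | by rewrite idealr1 | move=> a u v uI vI].
  by rewrite rpredD // idealMr.
- split; [split=> [||a u v]|move=> u v].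
  + by rewrite mem rmorph0 idealr0.
  + by rewrite mem rmorph1 idealr1.
  + by rewrite !mem rmorphD rmorphM => uI vI; rewrite rpredD // idealMr.
  + by rewrite !mem rmorphM prime_idealrM.
- by move=> x /pi_ideal_eq0; rewrite mem => ->; exact: idealr0.
- move=> x /=; rewrite to_loc_eq0; split=> [[s]|[s]].
    rewrite -[s]reprK => sM e; exists (repr s) => //; apply/pi_ideal_eq0.
    by rewrite rmorphM.
  by move=> sM /pi_ideal_eq0; rewrite rmorphM => e; exists (\pi s).
- move=> t; have [s sM [x e]] := to_loc_surj t.
  by exists (repr s); rewrite ?mem ?reprK //; exists (repr x); rewrite /= !reprK.
- by move=> s sM; exact: to_loc_unit.
Qed.

End QuotientLocalization.

(** * Regular triples and algebraic dependence *)

Definition ideal_like (T : comNzRingType) (J : T -> Prop) : Prop :=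
  J 0 /\ forall a x y, J x -> J y -> J (a * x + y).

Definition nonzerodiv_mod (T : comNzRingType) (J : T -> Prop) (y : T) : Prop :=
  forall x, J (y * x) -> J x.

Section LexicographicArgument.
Variables (T : comNzRingType).
Implicit Types (J : T -> Prop) (x y : T) (G : nat -> T).

Lemma ideal_likeM J a x : ideal_like J -> J x -> J (a * x).
Proof. by case=> J0 Jlin Jx; rewrite -[_ * _]addr0; apply: Jlin. Qed.

Lemma ideal_like_span (E : T -> Prop) : ideal_like (ideal_span E).
Proof. by split; [exact: ideal_span0 | move=> a x y; exact: ideal_span_lin]. Qed.

Lemma ideal_like_mem (I : {pred T}) : idealr_closed I -> ideal_like (fun x => x \in I).
Proof. by case=> I0 _ Ilin; split=> // a x y; exact: Ilin. Qed.

(** Since [y] is regular modulo [J], the factor [y ^+ a0] cancels; what remains is [G a0] plus a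
    multiple of [y], and [y] lies in [J']. *)
Lemma lowest_coeff_mem J J' G y N a0 :
  ideal_like J' -> (forall x, J x -> J' x) -> J' y ->
  nonzerodiv_mod J y -> (a0 < N)%N -> (forall a, (a < a0)%N -> G a = 0) ->
  J (\sum_(a < N) G a * y ^+ a) -> J' (G a0).
Proof.
move=> idJ' JJ' J'y regy a0N G0.
rewrite -(big_mkord xpredT (fun a => G a * y ^+ a)) (big_cat_nat (leq0n a0) (ltnW a0N)) //=.
rewrite big_nat big1 => [|a /andP[_ /G0->]]; last by rewrite mul0r.
rewrite add0r big_ltn //.
have -> : G a0 * y ^+ a0 + \sum_(a0.+1 <= a < N) G a * y ^+ a =
  y ^+ a0 * (G a0 + y * \sum_(a0.+1 <= a < N) G a * y ^+ (a - a0.+1)).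
  rewrite mulrDr [_ * G a0]mulrC; congr (_ + _); rewrite mulrA -exprSr mulr_sumr.
  by apply: eq_big_nat => a /andP[a0a _]; rewrite mulrCA -exprD subnKC.
set g := _ + y * _ => Jg.
have /JJ' J'g : J g.
  by elim: (a0) Jg => [|k IHk]; rewrite ?expr0 ?mul1r // exprS -mulrA => /regy.
have [_ J'lin] := idJ'; rewrite -[G a0](addrK (y * \sum_(a0.+1 <= a < N) G a * y ^+ (a - a0.+1))).
rewrite -/g addrC mulrC -mulNr; exact: J'lin.
Qed.

Variables (A : fieldType) (kappa : {rmorphism A -> T}).

(* A nonzero polynomial relation between three elements, each a nonzerodivisor
   modulo its predecessors: cancel the lowest powers one variable at a time. *)
Lemma no_regular_dependent_triple (J : nat -> T -> Prop) (y1 y2 y3 : T) N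
    (c : nat -> nat -> nat -> A) :
  (forall i, ideal_like (J i)) -> (forall i x, J i x -> J i.+1 x) ->
  J 1%N y1 -> J 2%N y2 -> J 3%N y3 ->
  nonzerodiv_mod (J 0%N) y1 -> nonzerodiv_mod (J 1%N) y2 -> nonzerodiv_mod (J 2%N) y3 ->
  (exists a b d, [/\ (a < N)%N, (b < N)%N, (d < N)%N & c a b d != 0]) ->
  J 0%N (\sum_(a < N) \sum_(b < N) \sum_(d < N)
           kappa (c a b d) * y1 ^+ a * y2 ^+ b * y3 ^+ d) ->
  J 3%N 1.
Proof.
move=> idJ JS J1 J2 J3 r1 r2 r3 exc rel.
pose Ex2 a b := [exists d : 'I_N, c a b d != 0].
pose Ex1 a := [exists b : 'I_N, Ex2 a b].
have ex1 : exists a, (a < N)%N && Ex1 a.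
  have [a [b [d [aN bN dN cn]]]] := exc; exists a; rewrite aN; apply/existsP.
  by exists (Ordinal bN); apply/existsP; exists (Ordinal dN).
have [a0 /andP[a0N Ea0] mina] := ex_minnP ex1.
have ex2 : exists b, (b < N)%N && Ex2 a0 b.
  by have [b eb] := existsP Ea0; exists b; rewrite ltn_ord.
have [b0 /andP[b0N Eb0] minb] := ex_minnP ex2.
have ex3 : exists d, (d < N)%N && (c a0 b0 d != 0).
  by have [d ed] := existsP Eb0; exists d; rewrite ltn_ord.
have [d0 /andP[d0N cn0] mind] := ex_minnP ex3.
pose H a b := \sum_(d < N) kappa (c a b d) * y3 ^+ d.
pose G a := \sum_(b < N) H a b * y2 ^+ b.
have G0 a : (a < a0)%N -> G a = 0.
  move=> aa; have aN := ltn_trans aa a0N.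
  apply: big1 => b _; rewrite [H _ _]big1 ?mul0r // => d _.
  suff /eqP-> : c a b d == 0 by rewrite rmorph0 mul0r.
  apply: contraLR aa => cn; rewrite -leqNgt mina // aN.
  by apply/existsP; exists b; apply/existsP; exists d.
have H0 b : (b < b0)%N -> H a0 b = 0.
  move=> bb; have bN := ltn_trans bb b0N.
  apply: big1 => d _; suff /eqP-> : c a0 b d == 0 by rewrite rmorph0 mul0r.
  apply: contraLR bb => cn; rewrite -leqNgt minb // bN.
  by apply/existsP; exists d.
have K0 d : (d < d0)%N -> kappa (c a0 b0 d) = 0.
  move=> dd; have dN := ltn_trans dd d0N.
  suff /eqP-> : c a0 b0 d == 0 by rewrite rmorph0.
  by apply: contraLR dd => cn; rewrite -leqNgt mind // dN.
have relG : J 0%N (\sum_(a < N) G a * y1 ^+ a).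
  congr (J 0%N _): rel; apply: eq_bigr => a _; rewrite mulr_suml.
  apply: eq_bigr => b _; rewrite !mulr_suml; apply: eq_bigr => d _; ring.
have J1G := lowest_coeff_mem (idJ 1%N) (JS 0%N) J1 r1 a0N G0 relG.
have J2H := lowest_coeff_mem (idJ 2%N) (JS 1%N) J2 r2 b0N H0 J1G.
have J3K := lowest_coeff_mem (idJ 3%N) (JS 2%N) J3 r3 d0N K0 J2H.
have := ideal_likeM (kappa (c a0 b0 d0)^-1) (idJ 3%N) J3K.
by rewrite -rmorphM mulVf // rmorph1.
Qed.

End LexicographicArgument.

Section Counting.
Variables (A : fieldType) (n : nat).
Implicit Types (p q : {mpoly A[n]}) (m : 'X_{1..n}).

Definition deg_le p e := forall m, m \in msupp p -> (mdeg m <= e)%N.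

Lemma deg_leM p q d e : deg_le p d -> deg_le q e -> deg_le (p * q) (d + e).
Proof.
move=> pd qe m /msuppM_le/allpairsP[[m1 m2] /= [m1p m2q ->]].
by rewrite mdegD leq_add ?pd ?qe.
Qed.

Lemma deg_leX p d k : deg_le p d -> deg_le (p ^+ k) (d * k).
Proof.
move=> pd; elim: k => [|k IHk]; last by rewrite exprS mulnS; exact: deg_leM.
by move=> m; rewrite expr0 msupp1 inE => /eqP->; rewrite mdeg0.
Qed.

Lemma deg_leW p d e : (d <= e)%N -> deg_le p d -> deg_le p e.
Proof. by move=> de pd m /pd md; exact: leq_trans de. Qed.

Lemma deg_le_msize p d : (msize p <= d)%N -> deg_le p d.
Proof. by move=> pd m /msize_mdeg_lt mp; rewrite (leq_trans (ltnW mp)). Qed.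

(* Outside [U] there are O(L^2) monomials of degree at most [L], but there are
   N^3 products of powers smaller than [N] of three elements. *)
Lemma algebraic_dependence (U : 'X_{1..n} -> Prop) (W : nat) (y1 y2 y3 : {mpoly A[n]}) :
  (forall m, ~ U m -> exists i j : 'I_n, forall k, k != i -> k != j -> (m k < W)%N) ->
  exists N (c : nat -> nat -> nat -> A),
    (exists a b d, [/\ (a < N)%N, (b < N)%N, (d < N)%N & c a b d != 0]) /\
    forall m, m \in msupp (\sum_(a < N) \sum_(b < N) \sum_(d < N)
      (c a b d)%:MP * y1 ^+ a * y2 ^+ b * y3 ^+ d) -> U m.
Proof.
move=> smallU.
(* There are [n * n * W.+1 ^ n * L.+1 ^ 2] columns and [L.+1 <= (D * 3).+1 * N]; this [N] makes
   their number smaller than the [N ^ 3] rows. *)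
pose D := (msize y1 + msize y2 + msize y3)%N.
pose N := (n * n * W.+1 ^ n * (D * 3).+1 ^ 2).+1.
pose L := (D * N * 3)%N.
pose Col : finType := ('I_n * 'I_n * {ffun 'I_n -> 'I_W.+1} * 'I_L.+1 * 'I_L.+1)%type.
pose Row : finType := ('I_N * 'I_N * 'I_N)%type.
pose mon (j : Col) : 'X_{1..n} := let: (p, q, f, a, b) := j in
  [multinom if k == p then a : nat else if k == q then b : nat else f k | k < n].
pose prodpow (r : Row) : {mpoly A[n]} := let: (a, b, d) := r in y1 ^+ a * y2 ^+ b * y3 ^+ d.
have cardlt : (#|Col| < #|Row|)%N.
  rewrite !card_prod card_ffun !card_ord.
  apply: (@leq_ltn_trans (n * n * W.+1 ^ n * ((D * 3).+1 ^ 2 * N ^ 2))).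
    rewrite -mulnA leq_mul2l; apply/orP; right; rewrite -expnMn mulnn leq_exp2r //.
    by rewrite mulSn ltnS /L mulnAC leq_addl.
  by rewrite mulnA -[(N * N * N)%N]mulnA ltn_pmul2r.
pose Mx : 'M[A]_(#|Row|, #|Col|) :=
  \matrix_(i, j) (prodpow (enum_val i))@_(mon (enum_val j)).
(* With more rows than columns, a nonzero row vector [v] annihilates [Mx]; its entries are the
   coefficients of the relation. *)
have kn0 : kermx Mx != 0.
  rewrite -mxrank_eq0 mxrank_ker subn_eq0 -ltnNge.
  exact: leq_ltn_trans (rank_leq_col _) cardlt.
have [v /sub_kermxP vM v0] := rowV0Pn kn0.
pose lift3 (a b d : nat) : option Row :=
  if (insub a, insub b, insub d) is (Some a', Some b', Some d') then Some (a', b', d')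
  else None.
pose c a b d := if lift3 a b d is Some r then v 0 (enum_rank r) else 0.
have cE (a b d : 'I_N) : c a b d = v 0 (enum_rank ((a, b, d) : Row)).
  by rewrite /c /lift3 !valK.
exists N, c; split.
  have [i vi] : exists i, v 0 i != 0.
    apply: contrapT => nov; case/negP: v0; apply/eqP/rowP => i; rewrite mxE.
    by apply/eqP/negPn/negP => vi; apply: nov; exists i.
  case e: (enum_val i) => [[a b] d]; exists a, b, d; split; rewrite ?ltn_ord //.
  by rewrite cE -e enum_valK.
set p := \sum_(a < N) _.
have pE : p = \sum_(i < #|Row|) v 0 i *: prodpow (enum_val i).
  rewrite (reindex_onto (@enum_rank Row) (@enum_val Row predT)) /=; last first.
    by move=> i _; rewrite enum_valK.
  transitivity (\sum_(r : Row) v 0 (enum_rank r) *: prodpow r); last first.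
    by apply: eq_big => [r|r _]; rewrite ?enum_rankK ?eqxx.
  rewrite /p pair_big pair_big /=; apply: eq_bigr => -[[a b] d] _ /=.
  by rewrite cE -mul_mpolyC !mulrA.
have pdeg : deg_le p L.
  have sumle (J : finType) (F : J -> {mpoly A[n]}) :
      (forall j, deg_le (F j) L) -> deg_le (\sum_j F j) L.
    move=> FL m /msupp_sum_le/flatten_mapP[j _ mj]; exact: FL mj.
  rewrite pE; apply: sumle => i m /msuppZ_le.
  case: (enum_val i) => [[a b] d] /=.
  have yd (y : {mpoly A[n]}) (a' : 'I_N) : (msize y <= D)%N -> deg_le (y ^+ a') (D * N).
    move=> yD; apply: (@deg_leW _ (D * a')).
      by rewrite leq_mul2l ltnW ?orbT.
    exact/deg_leX/deg_le_msize.
  have -> : L = (D * N + D * N + D * N)%N by rewrite /L; move: (D * N)%N => x; lia.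
  suff : deg_le (y1 ^+ a * y2 ^+ b * y3 ^+ d) (D * N + D * N + D * N) by apply.
  by apply: deg_leM; [apply: deg_leM|]; apply: yd; rewrite /D; lia.
move=> m mp; apply: contrapT => /smallU[i [j mW]].
have mL k : (m k < L.+1)%N.
  rewrite ltnS; apply: leq_trans (pdeg m mp); rewrite mdegE (bigD1 k) //=.
  exact: leq_addr.
pose f : {ffun 'I_n -> 'I_W.+1} := [ffun k => inord (m k)].
pose col : Col := (i, j, f, Ordinal (mL i), Ordinal (mL j)).
have mE : mon col = m.
  apply/mnmP => k; rewrite mnmE /=; case: eqP => [->//|/eqP ki].
  by case: eqP => [->//|/eqP kj]; rewrite ffunE inordK // ltnW // ltnS mW.
have : p@_m = 0.
  have /rowP/(_ (enum_rank col)) := vM; rewrite !mxE => e.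
  rewrite pE raddf_sum -[RHS]e; apply: eq_bigr => r _.
  by rewrite /= mcoeffZ mxE enum_rankK mE.
by apply/eqP; rewrite mcoeff_eq0 mp.
Qed.

End Counting.

Lemma cohen_macaulay_local_intro (T : comNzRingType) (M : {pred T}) d :
  local_ring M ->
  (exists P : 'I_d.+1 -> {pred T}, prime_chain P) ->
  (forall e (P : 'I_e.+1 -> {pred T}), prime_chain P -> (e <= d)%N) ->
  (exists s, [/\ {subset s <= M}, regular_seq s & size s = d]) ->
  (forall s, {subset s <= M} -> regular_seq s -> (size s <= d)%N) ->
  cohen_macaulay_local T.
Proof. by move=> locM chP boundP regs bounds; exists M; split=> //; exists d. Qed.

(** * Upper bounds for dimension and depth *)

Section DimensionBound.
Variables (A : fieldType) (n : nat) (T : comNzRingType).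
Variables (I M : {pred {mpoly A[n]}}) (psi : {rmorphism {mpoly A[n]} -> T}).
Hypothesis loc : localizes I M psi.
Variables (U : 'X_{1..n} -> Prop) (W : nat).
Hypothesis UI : forall p, (forall m, m \in msupp p -> U m) -> p \in I.
Hypothesis smallU : forall m, ~ U m ->
  exists i j : 'I_n, forall k, k != i -> k != j -> (m k < W)%N.

Lemma no_regular_triple (J : nat -> T -> Prop) (y1 y2 y3 : T) :
  (forall i, ideal_like (J i)) -> (forall i x, J i x -> J i.+1 x) ->
  J 1%N y1 -> J 2%N y2 -> J 3%N y3 ->
  nonzerodiv_mod (J 0%N) y1 -> nonzerodiv_mod (J 1%N) y2 -> nonzerodiv_mod (J 2%N) y3 ->
  J 3%N 1.
Proof.
move=> idJ JS J1 J2 J3 r1 r2 r3.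
have num i y : J i.+1 y -> nonzerodiv_mod (J i) y ->
    exists x, J i.+1 (psi x) /\ nonzerodiv_mod (J i) (psi x).
  move=> Jy ry; have [s sM [x e]] := localizes_surj loc y; exists x; rewrite -e.
  split=> [|t]; first exact: ideal_likeM.
  have [v ve] := localizes_unit loc sM.
  move=> /(ideal_likeM v (idJ i)); rewrite !mulrA ve mul1r; exact: ry.
have [x1 [Jx1 rx1]] := num 0%N y1 J1 r1; have [x2 [Jx2 rx2]] := num 1%N y2 J2 r2.
have [x3 [Jx3 rx3]] := num 2%N y3 J3 r3.
have [N [c [c0 /UI cI]]] := algebraic_dependence x1 x2 x3 smallU.
apply: (no_regular_dependent_triple (kappa := psi \o @mpolyC n A)
  idJ JS Jx1 Jx2 Jx3 rx1 rx2 rx3 c0).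
have : psi (\sum_(a < N) \sum_(b < N) \sum_(d < N)
      (c a b d)%:MP * x1 ^+ a * x2 ^+ b * x3 ^+ d) = 0.
  apply/(localizes_ker loc); exists 1; last by rewrite mul1r.
  by case: (localizes_prime loc) => -[].
rewrite rmorph_sum => e; have [J00 _] := idJ 0%N; rewrite -{}e in J00.
congr (J 0%N _): J00; apply: eq_bigr => a _; rewrite rmorph_sum; apply: eq_bigr => b _.
by rewrite rmorph_sum; apply: eq_bigr => d _; rewrite !rmorphM !rmorphXn.
Qed.

(** Modulo a prime, an element of the next prime outside it is a nonzerodivisor, so a strict chain
    of four primes would give a regular triple. *)
Lemma prime_chain_le2 e (P : 'I_e.+1 -> {pred T}) : prime_chain P -> (e <= 2)%N.
Proof.
case=> prP chP; rewrite leqNgt; apply/negP => e3.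
(* Capping the index at 3 extends the first four primes to a sequence indexed by all naturals,
   constant from 3 on. *)
have bnd i : (minn i 3 < e.+1)%N by rewrite ltnS (leq_trans (geq_minr _ _)).
pose Q i := P (Ordinal (bnd i)).
have prQ i : prime_ideal (Q i) by exact: prP.
have idQ i : ideal_like (fun t => t \in Q i) by apply: ideal_like_mem; case: (prQ i).
have step i : (i < 3)%N -> {subset Q i <= Q i.+1} /\
    exists2 y, y \in Q i.+1 & nonzerodiv_mod (fun t => t \in Q i) y.
  move=> i3; have [|sub [y yi yN]] := chP (Ordinal (bnd i)) (Ordinal (bnd i.+1)).
    by rewrite /= (minn_idPl (ltnW i3)) (minn_idPl i3).
  by split=> //; exists y => // t; rewrite prime_idealM // (negbTE yN).
have subQ i x : x \in Q i -> x \in Q i.+1.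
  have [/step[+ _]|i3] := ltnP i 3; first exact.
  rewrite /Q; suff -> : Ordinal (bnd i) = Ordinal (bnd i.+1) by [].
  by apply: val_inj; rewrite /= !(minn_idPr _) // ltnW.
have [_ [y1 J1 r1]] := step 0%N isT; have [_ [y2 J2 r2]] := step 1%N isT.
have [_ [y3 J3 r3]] := step 2%N isT.
have := no_regular_triple idQ subQ J1 J2 J3 r1 r2 r3.
by case: (prQ 3%N) => -[_ /negP].
Qed.

Lemma regular_seq_le2 (s : seq T) : regular_seq s -> (size s <= 2)%N.
Proof.
case=> regs prop; rewrite leqNgt; apply/negP => s3.
pose J i := ideal_span (fun y => y \in take i s).
have subJ i x : J i x -> J i.+1 x.
  apply: span_sub => y yi; apply: span_gen.
  by rewrite -(take_takel s (leqnSn i)) in yi; exact: mem_take yi.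
have memJ i : (i < size s)%N -> J i.+1 (nth 0 s i).
  by move=> si; apply: span_gen; rewrite (take_nth 0) // mem_rcons mem_head.
apply: prop.
have := no_regular_triple (fun i => ideal_like_span _) subJ
  (memJ 0%N (ltnW (ltnW s3))) (memJ 1%N (ltnW s3)) (memJ 2%N s3)
  (regs _ (ltnW (ltnW s3))) (regs _ (ltnW s3)) (regs _ s3).
by apply: span_sub => y /mem_take ys; exact: span_gen.
Qed.

End DimensionBound.

(** * Regular pairs modulo monomial ideals *)

Section Filtration.
Variables (R : comNzRingType) (J J1 J2 : R -> Prop) (u f g : R).
Hypotheses (idJ : ideal_like J) (idJ1 : ideal_like J1) (idJ2 : ideal_like J2).
Hypotheses (colon : forall x, J (u * x) <-> J1 x).
Hypotheses (sum_elim : forall x, J2 x -> exists y, J (x - u * y)).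
Hypotheses (sub_sum : forall x, J x -> J2 x) (mem_sum : J2 u).

Lemma ideal_likeB (K : R -> Prop) x y : ideal_like K -> K x -> K y -> K (x - y).
Proof. by case=> _ Klin Kx Ky; rewrite addrC -mulN1r; exact: Klin. Qed.

Lemma ideal_likeD (K : R -> Prop) x y : ideal_like K -> K x -> K y -> K (x + y).
Proof. by case=> _ Klin Kx Ky; rewrite -[x]mul1r; exact: Klin. Qed.

(** Here [J1] is the colon ideal of [J] by [u] and [J2] is [J] plus the multiples of [u]. This is
    the exact sequence 0 -> R/J1 -> R/J -> R/J2 -> 0 whose first map is multiplication by [u];
    regularity passes from the ends to the middle. *)
Lemma nonzerodiv_filtration :
  nonzerodiv_mod J1 f -> nonzerodiv_mod J2 f -> nonzerodiv_mod J f.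
Proof.
move=> r1 r2 x Jfx; have [y Jy] := sum_elim (r2 _ (sub_sum Jfx)).
rewrite -[x](subrK (u * y)); apply: ideal_likeD => //; apply/colon/r1/colon.
have -> : u * (f * y) = f * x - f * (x - u * y) by ring.
by apply: ideal_likeB => //; exact: ideal_likeM.
Qed.

(* The regular sequences of length 2, without the requirement that [a] and [b]
   generate a proper ideal modulo [K]. *)
Definition regular_pair_mod (K : R -> Prop) (a b : R) : Prop :=
  nonzerodiv_mod K a /\
  forall x y, K (b * x - a * y) -> exists z, K (x - a * z).

Lemma regular_pair_filtration :
  regular_pair_mod J1 f g -> regular_pair_mod J2 f g -> regular_pair_mod J f g.
Proof.
move=> [r1 s1] [r2 s2]; split; first exact: nonzerodiv_filtration.
(* Write [x = f * z + u * t] modulo [J]. Then [y - g * z = u * m] modulo [J], and cancelling [u]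
   leaves [g * t = f * m] modulo [J1], so that [t] is a multiple of [f] there. *)
move=> x y Jxy; have [z J2z] := s2 x y (sub_sum Jxy).
have [t Jt] := sum_elim J2z.
have Jgt : J (g * (u * t) - f * (y - g * z)).
  have -> : g * (u * t) - f * (y - g * z) = (g * x - f * y) - g * (x - f * z - u * t).
    by ring.
  by apply: ideal_likeB => //; exact: ideal_likeM.
have J2f : J2 (f * (y - g * z)).
  have -> : f * (y - g * z) = g * t * u - (g * (u * t) - f * (y - g * z)) by ring.
  by apply: ideal_likeB => //; [exact: ideal_likeM | exact: sub_sum].
have [m Jm] := sum_elim (r2 _ J2f).
have [|k J1k] := s1 t m.
  apply/colon; have -> : u * (g * t - f * m) =
     (g * (u * t) - f * (y - g * z)) + f * (y - g * z - u * m) by ring.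
  by apply: ideal_likeD => //; exact: ideal_likeM.
exists (z + u * k).
have -> : x - f * (z + u * k) = (x - f * z - u * t) + u * (t - f * k) by ring.
by apply: ideal_likeD => //; apply/colon.
Qed.

End Filtration.

Section MonomialIdeals.
Variables (A : fieldType) (n : nat).
Implicit Types (p x y : {mpoly A[n]}) (m : 'X_{1..n}) (U : 'X_{1..n} -> Prop).

(** For an upward closed [U] this is membership in the monomial ideal spanned by the exponents in
    [U]. *)
Definition mon_in U p : Prop := forall m, m \in msupp p -> U m.

Definition upclosed U : Prop := forall m m', U m -> U (m + m')%MM.

Lemma mon_inP U p : mon_in U p <-> forall m, ~ U m -> p@_m = 0.
Proof.
split=> [Up m nU|Up m]; first by apply/eqP; rewrite mcoeff_eq0; apply/negP => /Up.
by rewrite mcoeff_msupp => /eqP pm; apply: contrapT => /Up.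
Qed.

Lemma mon_in_ideal U : upclosed U -> ideal_like (mon_in U).
Proof.
move=> upU; split=> [m|a x y Ux Uy m]; first by rewrite msupp0.
move/msuppD_le; rewrite mem_cat => /orP[|/Uy//].
by move=> /msuppM_le/allpairsP[[m1 m2] /= [_ /Ux Um2 ->]]; rewrite addmC; exact: upU.
Qed.

(* Exponents of the ideal generated by the powers [X_k ^ (a k)] with [a k > 0];
   [a k = 0] means that no power of [X_k] is among the generators. *)
Definition purepow (a : 'I_n -> nat) m : bool := [exists k, 0 < a k <= m k]%N.

Lemma purepow_up a : upclosed (purepow a).
Proof.
move=> m m' /existsP[k /andP[ak am]]; apply/existsP; exists k.
by rewrite ak mnmDE (leq_trans am) ?leq_addr.
Qed.

Lemma purepow_ideal a : ideal_like (mon_in (purepow a)).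
Proof. exact/mon_in_ideal/purepow_up. Qed.

Definition upd (a : 'I_n -> nat) (k : 'I_n) v : 'I_n -> nat :=
  fun l => if l == k then v else a l.

(** Dividing by [X_k] lowers its exponent by one. The bound [1 < a k] keeps the new exponent
    positive, as 0 would mean that the generator disappears. *)
Lemma purepow_colon a k x : (1 < a k)%N ->
  mon_in (purepow a) ('X_k * x) <-> mon_in (purepow (upd a k (a k).-1)) x.
Proof.
move=> ak; have pk m : purepow a (U_(k) + m)%MM = purepow (upd a k (a k).-1) m.
  apply: eq_existsb => l; rewrite /upd mnmDE mnm1E eq_sym.
  by have [->|] := eqVneq l k; rewrite ?add0n //; lia.
split=> [/mon_inP Ux|Ux m].
  by apply/mon_inP => m; rewrite -pk => /Ux; rewrite mulrC mcoeffMX.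
by move=> /msuppM_le/allpairsP[[m1 m2] /=]; rewrite msuppX inE => -[/eqP-> /Ux + ->]; rewrite pk.
Qed.

Lemma purepow_sum_elim a k x : (0 < a k)%N -> mon_in (purepow (upd a k 1)) x ->
  exists y, mon_in (purepow a) (x - 'X_k * y).
Proof.
move=> ak Ux; exists (\sum_(m <- msupp x | ~~ purepow a m) x@_m *: 'X_[m - U_(k)]).
have -> : 'X_k * \sum_(m <- msupp x | ~~ purepow a m) x@_m *: 'X_[m - U_(k)] =
    \sum_(m <- msupp x | ~~ purepow a m) x@_m *: 'X_[m].
  rewrite mulr_sumr big_seq_cond [RHS]big_seq_cond; apply: eq_bigr => m /andP[mx nm].
  rewrite -scalerAr -mpolyXD addmC submK // lep1mP.
  have /existsP[l] := Ux m mx; rewrite /upd; have [->|lk] := eqVneq l k.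
    by rewrite -lt0n.
  by move=> alm; case/negP: nm; apply/existsP; exists l.
rewrite [x in x - _]mpolyE (bigID (purepow a)) /= addrK => m.
move=> /msupp_sum_le/flatten_mapP[m']; rewrite mem_filter => /andP[pm' _] /msuppZ_le.
by rewrite msuppX inE => /eqP->.
Qed.

Lemma purepow_sub_sum a k x : (0 < a k)%N ->
  mon_in (purepow a) x -> mon_in (purepow (upd a k 1)) x.
Proof.
move=> ak Ux m /Ux/existsP[l alm]; apply/existsP; exists l; rewrite /upd.
by have [e|//] := eqVneq l k; move: alm; rewrite e; lia.
Qed.

Lemma purepow_mem_sum a k : mon_in (purepow (upd a k 1)) 'X_k.
Proof.
move=> m; rewrite msuppX inE => /eqP->; apply/existsP; exists k.
by rewrite /upd mnm1E eqxx.
Qed.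

(* It suffices to treat exponents at most 1: otherwise split along [X_k] with [a k > 1]. *)
Lemma purepow_induction (Pr : ({mpoly A[n]} -> Prop) -> Prop) :
  (forall J J1 J2 u, ideal_like J -> ideal_like J1 -> ideal_like J2 ->
    (forall x, J (u * x) <-> J1 x) ->
    (forall x, J2 x -> exists y, J (x - u * y)) ->
    (forall x, J x -> J2 x) -> J2 u -> Pr J1 -> Pr J2 -> Pr J) ->
  forall a,
  (forall b, (forall k, b k <= 1)%N -> (forall k, (b k == 0%N) = (a k == 0%N)) ->
    Pr (mon_in (purepow b))) ->
  Pr (mon_in (purepow a)).
Proof.
move=> step a; have [N] := ubnP (\sum_k a k); elim: N a => // N IHN a aN base.
have [/existsP[k ak]|noak] := boolP [exists k, 1 < a k]%N; last first.
  by apply: base => // k; rewrite leqNgt; apply: contra noak => ak; apply/existsP; exists k.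
have less v : (v < a k)%N -> (0 < v)%N -> Pr (mon_in (purepow (upd a k v))).
  move=> va v0; apply: IHN => [|b b1 eb].
    apply: leq_trans (_ : _ <= \sum_l a l)%N _; last by rewrite -ltnS.
    rewrite (bigD1 k) //= [leqRHS](bigD1 k) //= -addSn /upd eqxx leq_add //.
    by apply: leq_sum => l /negbTE->.
  apply: base => // l; rewrite eb /upd; have [->|//] := eqVneq l k; lia.
have ak0 := ltnW ak.
by apply: (step _ _ _ 'X_k (purepow_ideal a) (purepow_ideal _) (purepow_ideal _)
  (fun x => purepow_colon x ak) (fun x => purepow_sum_elim ak0 (x := x))
  (fun x => purepow_sub_sum ak0 (x := x)) (@purepow_mem_sum a k)); apply: less; lia.
Qed.

(** Evaluation after setting to zero the variables with [a k > 0]. When all [a k] are at most 1 it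
    factors through the quotient by the monomial ideal of [a]. *)
Definition kill (a : 'I_n -> nat) (B : comNzRingType) (phi : {rmorphism A -> B})
    (h : 'I_n -> B) : {mpoly A[n]} -> B :=
  mmap phi (fun k => if a k == 0%N then h k else 0).

HB.instance Definition _ a B phi h :=
  GRing.RMorphism.copy (@kill a B phi h)
    (mmap phi (fun k => if a k == 0%N then h k else 0)).

Section Kill.
Variables (a : 'I_n -> nat) (B : comNzRingType) (phi : {rmorphism A -> B}) (h : 'I_n -> B).

Lemma killX k : kill a phi h 'X_k = if a k == 0%N then h k else 0.
Proof. by rewrite /kill mmapX mmap1U. Qed.

Lemma killC c : kill a phi h c%:MP = phi c.
Proof. exact: mmapC. Qed.

Hypothesis a1 : forall k, (a k <= 1)%N.

Lemma killE p : kill a phi h p =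
  \sum_(m <- msupp p | ~~ purepow a m) phi p@_m * \prod_(k < n | a k == 0%N) h k ^+ m k.
Proof.
rewrite /kill /mmap [RHS]big_mkcond /=; apply: eq_bigr => m _; rewrite /mmap1.
have [nm|/negbNE/existsP[k /andP[ak am]]] := ifPn (~~ purepow a m); last first.
  rewrite (bigD1 k) //= (_ : a k == 0%N = false); last by lia.
  by rewrite expr0n (_ : m k == 0%N = false) ?mul0r ?mulr0 //; lia.
congr (_ * _); rewrite [RHS]big_mkcond /=; apply: eq_bigr => k _.
case: ifP => // ak; have /existsPn/(_ k) := nm.
by have := a1 k; case: (m k) => [|l]; [rewrite expr0 | lia].
Qed.

Lemma kill_eq0 p : mon_in (purepow a) p -> kill a phi h p = 0.
Proof. by move=> Up; rewrite killE big_seq_cond big1 // => m /andP[/Up->]. Qed.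

End Kill.

Section KillSelf.
Variable a : 'I_n -> nat.
Hypothesis a1 : forall k, (a k <= 1)%N.

Notation kappa := (kill a (@mpolyC n A) (fun k => 'X_k)).

Lemma kill_self p : mon_in (purepow a) (p - kappa p).
Proof.
have -> : kappa p = \sum_(m <- msupp p | ~~ purepow a m) p@_m *: 'X_[m].
  rewrite killE //; apply: eq_bigr => m nm; rewrite mul_mpolyC mpolyXE_id.
  congr (_ *: _); rewrite big_mkcond /=; apply: eq_bigr => k _; case: ifP => // ak.
  have /existsPn/(_ k) := nm.
  by have := a1 k; case: (m k) => [|l]; [rewrite expr0 | lia].
rewrite [p in p - _]mpolyE (bigID (purepow a)) /= addrK => m.
move=> /msupp_sum_le/flatten_mapP[m']; rewrite mem_filter => /andP[pm' _] /msuppZ_le.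
by rewrite msuppX inE => /eqP->.
Qed.

Lemma kill_self_eq0 p : kappa p = 0 <-> mon_in (purepow a) p.
Proof.
split=> [e|]; last exact: kill_eq0.
by have := @kill_self p; rewrite e subr0.
Qed.

Lemma kill_self_idem p : kappa (kappa p) = kappa p.
Proof.
by apply/esym/eqP; rewrite -subr_eq0 -rmorphB; apply/eqP/kill_self_eq0/kill_self.
Qed.

End KillSelf.

Definition pvar (f : {poly A}) (k : 'I_n) : {mpoly A[n]} :=
  (map_poly (@mpolyC n A) f).['X_k].

Lemma rmorph_pvar (B : comNzRingType) (psi : {rmorphism {mpoly A[n]} -> B}) f k :
  psi (pvar f k) = (map_poly (psi \o @mpolyC n A) f).[psi 'X_k].
Proof. by rewrite /pvar -horner_map -map_poly_comp. Qed.

Lemma kill_pvar a (B : comNzRingType) (phi : {rmorphism A -> B}) (h : 'I_n -> B) f k :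
  kill a phi h (pvar f k) = (map_poly phi f).[if a k == 0%N then h k else 0].
Proof.
rewrite (rmorph_pvar (kill a phi h)) /= killX; congr (_.[_]).
by apply: eq_map_poly => c; rewrite /= killC.
Qed.

Section PowerSums.
Variable u : 'I_n -> {poly A}.
Hypotheses (u0 : forall k, u k != 0) (u00 : forall k, (u k)`_0 = 0).

Notation uvar k := (pvar (u k) k).

(** [usum] and [upairs] are the first two elementary symmetric functions of the [uvar k]. As [u k]
    has no constant term, setting all variables but two to zero leaves a sum and a product. *)
Definition usum : {mpoly A[n]} := \sum_k uvar k.

Definition upairs : {mpoly A[n]} := \sum_(i < n) \sum_(j < n | (i < j)%N) uvar i * uvar j.

Lemma kill_uvar a (B : comNzRingType) (phi : {rmorphism A -> B}) (h : 'I_n -> B) k :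
  kill a phi h (uvar k) = if a k == 0%N then (map_poly phi (u k)).[h k] else 0.
Proof.
rewrite kill_pvar; case: ifP => // _.
by rewrite horner_coef0 coef_map /= u00 rmorph0.
Qed.

Lemma usum_notin (a : 'I_n -> nat) (p : 'I_n) :
  (forall k, a k <= 1)%N -> a p = 0%N -> ~ mon_in (purepow a) usum.
Proof.
move=> a1 ap Uu; pose a' k := (k != p) : nat.
have a'1 k : (a' k <= 1)%N by rewrite /a' leq_b1.
have U'u : mon_in (purepow a') usum.
  move=> m /Uu/existsP[k akm]; apply/existsP; exists k; rewrite /a'.
  by have [e|kp] := eqVneq k p; [rewrite e ap in akm | lia].
have := kill_eq0 (@polyC A) (fun=> 'X) a'1 U'u.
rewrite /usum rmorph_sum (bigD1 p) //= big1 => [|k kp].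
  rewrite addr0 kill_uvar /a' eqxx /= => /eqP; rewrite -/(_ \Po _) comp_polyXr.
  by rewrite (negbTE (u0 p)).
by rewrite kill_uvar /a' kp.
Qed.

(** For exponents at most 1 the ideal is the kernel of a map into a domain, and [usum] lies outside
    it because the variable [X_p] survives; the general case follows by splitting. *)
Lemma usum_regular (a : 'I_n -> nat) (p : 'I_n) :
  a p = 0%N -> nonzerodiv_mod (mon_in (purepow a)) usum.
Proof.
move=> ap; apply: (@purepow_induction (fun J => nonzerodiv_mod J usum)).
  move=> J J1 J2 v iJ iJ1 iJ2 c e s m r1 r2.
  exact: (nonzerodiv_filtration iJ c e s r1 r2).
move=> b b1 eb x; rewrite -!kill_self_eq0 // rmorphM => /eqP.
rewrite mulf_eq0 => /orP[/eqP/kill_self_eq0 h|/eqP //].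
case: (@usum_notin b p b1 _ (h b1)); apply/eqP; by rewrite eb ap.
Qed.

End PowerSums.

End MonomialIdeals.

(** * Regular pairs in two variables *)

Section PlaneCase.
Variable A : fieldType.
Implicit Types (u v : {poly A}) (x y m k : {poly {poly A}}).

(** [map_poly polyC u] involves only the outer variable and [v%:P] only the inner one. Dividing the
    coefficients of [m] by [v] leaves a remainder [r] whose product with the former is divisible by
    [v]; the leading coefficient of [r] has degree below that of [v], so [r = 0]. *)
Lemma coprime_variables u v m k : u != 0 -> v != 0 ->
  map_poly polyC u * m = v%:P * k -> exists m', m = v%:P * m'.
Proof.
move=> u0 v0 e.
pose q := map_poly (fun c => c %/ v) m; pose r := map_poly (fun c => c %% v) m.
have mE : m = v%:P * q + r.
  apply/polyP => i; rewrite coefD coefCM !coef_map_id0 ?div0p ?mod0p //.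
  by rewrite mulrC -divp_eq.
have er : v%:P * (k - map_poly polyC u * q) = map_poly polyC u * r.
  by rewrite mulrBr -e mE; ring.
have [r0|r0] := eqVneq r 0; first by exists q; rewrite mE r0 addr0.
have lr : (size (lead_coef r) < size v)%N.
  by rewrite lead_coefE coef_map_id0 ?mod0p // ltn_modp.
have U0 : lead_coef u != 0 by rewrite lead_coef_eq0.
have := congr1 lead_coef er; rewrite !lead_coefM lead_coefC lead_coef_map mul_polyC.
set w := lead_coef (k - _) => el.
have w0 : w != 0.
  apply: contraNneq r0 => w0; move/eqP: el; rewrite w0 mulr0 eq_sym scaler_eq0.
  by rewrite (negbTE U0) lead_coef_eq0.
move: lr; rewrite -(size_scale (lead_coef r) U0) -el size_mul //.
by have := size_poly_gt0 w; rewrite w0; case: (size w) => // l _; rewrite addnS ltnNge leq_addr.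
Qed.

(** With U and V the two polynomials, the relation gives (U + V)(V x - y) = V^2 x. Since U, and
    hence U + V, is regular modulo V, both factors V cancel. *)
Lemma plane_regular u v x y : u != 0 -> u`_0 = 0 -> v != 0 ->
  map_poly polyC u * v%:P * x = (map_poly polyC u + v%:P) * y ->
  exists z, x = (map_poly polyC u + v%:P) * z.
Proof.
move=> u0 u00 v0; set U := map_poly polyC u => e.
have VI : injective (fun t : {poly {poly A}} => v%:P * t).
  by apply: mulfI; rewrite polyC_eq0.
have div m k : (U + v%:P) * m = v%:P * k -> exists m', m = v%:P * m'.
  move=> em; apply: (@coprime_variables u v m (k - m)) => //.
  by rewrite mulrBr -em; ring.
have eV : (U + v%:P) * (v%:P * x - y) = v%:P * (v%:P * x).
  by rewrite mulrBr -e; ring.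
have [m em] := div _ _ eV; move: eV; rewrite em mulrCA => /VI em'.
have [m' em''] := div _ _ em'; exists m'.
by apply: VI; rewrite -em' em'' mulrCA.
Qed.

End PlaneCase.

Section RegularPairs.
Variables (A : fieldType) (n : nat) (u : 'I_n -> {poly A}).
Hypotheses (u0 : forall k, u k != 0) (u00 : forall k, (u k)`_0 = 0).

(** After reduction to exponents at most 1 the quotient is the polynomial ring in [X_p] and [X_q],
    where [usum] and [upairs] become the sum and the product of polynomials in separate
    variables. *)
Lemma regular_pair_purepow (a : 'I_n -> nat) (p q : 'I_n) : (p < q)%N ->
  (forall k, (a k == 0%N) = (k == p) || (k == q)) ->
  regular_pair_mod (mon_in (purepow a)) (usum u) (upairs u).
Proof.
move=> pq apq.
apply: (@purepow_induction _ _ (fun J => regular_pair_mod J (usum u) (upairs u))).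
  move=> J J1 J2 v iJ iJ1 iJ2 c e s m r1 r2.
  exact: (regular_pair_filtration iJ iJ2 c e s m r1 r2).
move=> b b1 eb.
have bpq k : (b k == 0%N) = (k == p) || (k == q) by rewrite eb apq.
split; first by apply: (usum_regular u0 u00 (p := p)); apply/eqP; rewrite bpq eqxx.
have qp : (q == p) = false by apply/eqP => e; rewrite e ltnn in pq.
(* [pl] maps to polynomials over [{poly A}], with [X_p] as outer and [X_q] as inner variable;
   [sigma] substitutes them back. *)
pose phi : {rmorphism A -> {poly {poly A}}} := @polyC {poly A} \o @polyC A.
pose h (k : 'I_n) : {poly {poly A}} := if k == p then 'X else 'X%:P.
have [pl plE] : {pl : {rmorphism {mpoly A[n]} -> {poly {poly A}}} | pl =1 kill b phi h}.
  by exists (kill b phi h).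
pose sigma : {rmorphism {poly {poly A}} -> {mpoly A[n]}} := horner_eval ('X_p : {mpoly A[n]}) \o
  map_poly (horner_eval ('X_q : {mpoly A[n]}) \o map_poly (@mpolyC n A)).
have [kappa kappaE] : {kappa : {rmorphism {mpoly A[n]} -> {mpoly A[n]}} |
    kappa =1 kill b (@mpolyC n A) (fun k => 'X_k)}.
  by exists (kill b (@mpolyC n A) (fun k => 'X_k)).
have sigmapi x : sigma (pl x) = kappa x.
  rewrite plE kappaE !killE // (rmorph_sum sigma).
  apply: eq_bigr => m _.
  rewrite (rmorphM sigma) (rmorph_prod sigma); congr (_ * _).
    by rewrite /sigma /= map_polyC /= map_polyC /horner_eval !hornerC.
  apply: eq_bigr => k; rewrite bpq rmorphXn /sigma /h /=.
  case: (k == p) / eqP => [->|kp] /= => [_|/eqP->].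
    by rewrite map_polyX /horner_eval hornerX.
  by rewrite map_polyC /= map_polyX /horner_eval hornerC hornerX.
have uE k : pl (pvar (u k) k) = if k == p then map_poly polyC (u p)
    else if k == q then (u q)%:P else 0.
  rewrite plE kill_uvar // bpq /h; have [->|kp] := eqVneq k p.
    by rewrite (map_poly_comp _ (@polyC A)) -/(_ \Po _) comp_polyXr.
  have [->|//] := eqVneq k q.
  by rewrite (map_poly_comp _ (@polyC A)) horner_map /= -/(_ \Po _) comp_polyXr.
have usE : pl (usum u) = map_poly polyC (u p) + (u q)%:P.
  rewrite /usum rmorph_sum (bigD1 p) //= (bigD1 q) ?qp //= !uE !eqxx qp big1 ?addr0 //.
  by move=> k /andP[kp kq]; rewrite uE (negbTE kp) (negbTE kq).
have upE : pl (upairs u) = map_poly polyC (u p) * (u q)%:P.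
  rewrite /upairs rmorph_sum (bigD1 p) //= [X in _ + X]big1 ?addr0 => [|i ip].
    rewrite rmorph_sum (bigD1 q) //= [X in _ + X]big1 ?addr0 ?rmorphM ?uE ?eqxx ?qp //.
    move=> j /andP[pj jq]; rewrite rmorphM !uE eqxx (negbTE jq).
    by rewrite ifF ?mulr0 //; apply/eqP => e; rewrite e ltnn in pj.
  rewrite rmorph_sum big1 // => j ij; rewrite rmorphM !uE (negbTE ip).
  have [iq|iq] := eqVneq i q; last by rewrite mul0r.
  rewrite iq in ij; rewrite !ifF ?mulr0 //; apply/eqP => e.
    by rewrite e ltnn in ij.
  by rewrite e ltnNge (ltnW pq) in ij.
move=> x y /kill_eq0-/(_ _ phi h b1); rewrite -plE.
rewrite rmorphB !rmorphM upE usE => /eqP.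
rewrite subr_eq0 => /eqP/plane_regular[]// z ez; exists (sigma z).
apply/(kill_self_eq0 b1); rewrite -kappaE.
have kk t : kappa (kappa t) = kappa t by rewrite !kappaE; exact: kill_self_idem.
have : kappa (sigma (pl x)) = kappa (sigma (pl (usum u) * z)) by rewrite ez usE.
rewrite (rmorphM sigma) rmorphM !sigmapi !kk => e.
by rewrite rmorphB rmorphM e subrr.
Qed.

End RegularPairs.

(** * Ultrametric weights *)

Section Ultrametric.
Variables (n : nat) (w : 'I_n -> 'I_n -> nat).
Hypothesis w_sym : forall i j, i != j -> w i j = w j i.
Hypothesis w_gt0 : forall i j, i != j -> (0 < w i j)%N.
Implicit Types (i j k p q r s : 'I_n) (m : 'X_{1..n}).

Definition reverse_ultrametric : Prop := forall i j k,
  i != j -> j != k -> i != k -> (minn (w i k) (w k j) <= w i j)%N.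

Definition pathexp m : Prop := exists i j k, [/\ i != j, j != k, i != k &
  [/\ w i j <= m i, maxn (w i j) (w j k) <= m j & w j k <= m k]%N].

(* The component of the 2-path ideal at the minimal prime generated by all the
   variables but [X_p] and [X_q]. *)
Definition edgepow p q k : nat :=
  if (k == p) || (k == q) then 0%N else minn (w p k) (w q k).

Lemma edgepow_eq0 p q k : (edgepow p q k == 0%N) = (k == p) || (k == q).
Proof.
rewrite /edgepow; case: ifP => // /norP[kp kq].
by apply/negbTE; rewrite -lt0n leq_min !w_gt0 // eq_sym.
Qed.

Lemma notin_edgeP p q m : reflect
  (forall k, k != p -> k != q -> (m k < w p k)%N /\ (m k < w q k)%N)
  (~~ purepow (edgepow p q) m).
Proof.
apply: (iffP existsPn) => [nm k kp kq|lt k].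
  have := nm k; rewrite lt0n edgepow_eq0 /edgepow (negbTE kp) (negbTE kq) /=.
  by rewrite -ltnNge leq_min => /andP[].
rewrite lt0n edgepow_eq0 /edgepow; case: ifP => // /negbT; rewrite negb_or => /andP[kp kq].
by have [l1 l2] := lt k kp kq; rewrite -ltnNge leq_min l1.
Qed.

Hypothesis ultra : reverse_ultrametric.

(** If [m] avoids the component at [pq], every other vertex has an exponent below its weights to [p]
    and [q]. With the ultrametric inequality this forces all three vertices of the path into
    [{p, q}]. *)
Lemma path_in_edge m p q : pathexp m -> purepow (edgepow p q) m.
Proof.
move=> [i [j [k [ij jk ik [wi wj wk]]]]]; apply: contraT => /notin_edgeP lt.
move: wj; rewrite geq_max => /andP[wj1 wj2].
have out l l' : l != p -> l != q -> l != l' -> (w l l' <= m l)%N -> l' != p /\ l' != q.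
  move=> lp lq ll' wl; have [l1 l2] := lt l lp lq; split; apply/eqP => e.
    by move: l1; rewrite ltnNge -e -(w_sym ll') wl.
  by move: l2; rewrite ltnNge -e -(w_sym ll') wl.
have two l l' : l != l' -> l != p -> l != q -> l' != p -> l' != q ->
    (w l l' <= m l)%N -> (w l l' <= m l')%N -> false.
  move=> ll' lp lq l'p l'q wl wl'; have [l1 _] := lt l lp lq; have [l2 _] := lt l' l'p l'q.
  have := ultra ll' l'p lp; rewrite (w_sym lp) geq_min; lia.
have [jpq|] := boolP ((j == p) || (j == q)); last first.
  rewrite negb_or => /andP[jp jq].
  have ji : j != i by rewrite eq_sym.
  have [|ip iq] := out j i jp jq ji; first by rewrite (w_sym ji).
  exact: two ij ip iq jp jq wi wj1.
have nj l : l != j -> (w j l <= m l)%N -> (l == p) || (l == q).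
  move=> lj wl; apply: contraT; rewrite negb_or => /andP[lp lq].
  have [|jp jq] := out l j lp lq lj; first by rewrite w_sym.
  by rewrite (negbTE jp) (negbTE jq) in jpq.
have ipq : (i == p) || (i == q) by apply: (nj i ij); rewrite -(w_sym ij).
have kj : k != j by rewrite eq_sym.
have kpq := nj k kj wk.
move: ij jk ik; case/orP: ipq => /eqP->; case/orP: jpq => /eqP->;
  case/orP: kpq => /eqP->; by rewrite ?eqxx.
Qed.

Lemma top_two m : (1 < n)%N -> exists p q, [/\ p != q, (m q <= m p)%N &
  forall k, k != p -> k != q -> (m k <= m q)%N].
Proof.
move=> n1; pose i0 := Ordinal (ltnW n1); pose i1 := Ordinal n1.
pose p := [arg max_(i > i0) m i].
have [l lp] : exists l, l != p.
  by have [e|] := eqVneq i0 p; [exists i1; rewrite -e | exists i0].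
pose q := [arg max_(i > l | i != p) m i]; exists p, q.
have pmax k : (m k <= m p)%N by rewrite /p; case: arg_maxnP => // i _; apply.
rewrite /q; case: arg_maxnP => // i ip imax; split=> //; first by rewrite eq_sym.
by move=> k kp _; exact: imax.
Qed.

Section TopTwo.
Variables (m : 'X_{1..n}) (p q : 'I_n).
Hypotheses (pq : p != q) (mqp : (m q <= m p)%N).
Hypothesis top : forall k, k != p -> k != q -> (m k <= m q)%N.

(** For a violating vertex [k], the smallest weight of the triangle [p q k] is at most [m k] and
    occurs on two edges. These form a 2-path, admissible because [m k <= m q <= m p]. With
    [path_in_edge] this makes the 2-path ideal the intersection of its components. *)
Lemma top_two_notin : ~ pathexp m -> ~~ purepow (edgepow p q) m.
Proof.
move=> nopath; apply/notin_edgeP => k kp kq.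
have [pk qk] : p != k /\ q != k by rewrite ![_ == k]eq_sym.
have qp : q != p by rewrite eq_sym.
have mk := top kp kq.
have wpq := w_sym pq; have wpk := w_sym pk; have wqk := w_sym qk.
have up := ultra pq qk pk; have uk := ultra pk kq pq; have uq := ultra qk kp qp.
apply: contrapT => nlt; apply: nopath.
have [c1|c1] := leqP (w p k) (w q k).
  have [c2|c2] := leqP (w p q) (w q k).
    exists q, p, k; split=> //; split; lia.
  exists p, k, q; split=> //; split; lia.
have [c2|c2] := leqP (w p q) (w p k).
  exists p, q, k; split=> //; split; lia.
exists p, k, q; split=> //; split; lia.
Qed.

(* Any edge whose component misses [m] either meets [{p, q}] or is joined to it by
   one more such edge. *)
Lemma top_two_linked r s : r != p -> r != q -> s != p -> s != q -> r != s ->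
  ~~ purepow (edgepow p q) m -> ~~ purepow (edgepow r s) m ->
  ~~ purepow (edgepow p r) m.
Proof.
move=> rp rq sp sq rs /notin_edgeP pqm /notin_edgeP rsm; apply/notin_edgeP => k kp kr.
have [pr qr ps qs] : [/\ p != r, q != r, p != s & q != s] by rewrite ![p == _]eq_sym ![q == _]eq_sym.
have [p1 p2] := rsm p pr ps; have [q1 q2] := rsm q qr qs.
have [r1 r2] := pqm r rp rq; have [s1 s2] := pqm s sp sq.
have sr : s != r by rewrite eq_sym.
have [->|kq] := eqVneq k q.
  split=> //; apply: leq_trans (ultra pq qr pr).
  by rewrite leq_min (w_sym pr) (leq_ltn_trans mqp p1) q1.
have [->|ks] := eqVneq k s.
  split=> //; apply: leq_trans (ultra rs sp rp).
  by rewrite leq_min s1 (leq_ltn_trans (leq_trans (top sp sq) mqp) p1).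
by have [k1 _] := pqm k kp kq; have [k2 _] := rsm k kr ks.
Qed.

End TopTwo.

(** The edges whose components miss [m] are connected through shared vertices: each reaches the edge
    of the two largest exponents directly or via one further edge. *)
Lemma linked_const (V : Type) (m : 'X_{1..n}) (c : 'I_n -> 'I_n -> V) : (1 < n)%N ->
  (forall p q r s v, p != q -> r != s -> v \in [:: p; q] -> v \in [:: r; s] ->
     ~~ purepow (edgepow p q) m -> ~~ purepow (edgepow r s) m -> c p q = c r s) ->
  forall p q r s, p != q -> r != s ->
     ~~ purepow (edgepow p q) m -> ~~ purepow (edgepow r s) m -> c p q = c r s.
Proof.
move=> n1 share; have [p [q [pq mqp top]]] := top_two m n1.
suff toc r s : r != s -> ~~ purepow (edgepow r s) m -> c r s = c p q.
  by move=> p' q' r s p'q' rs m1 m2; rewrite (toc _ _ p'q' m1) (toc _ _ rs m2).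
move=> rs rsm.
have pqm : ~~ purepow (edgepow p q) m.
  apply: top_two_notin => // pm; case/negP: rsm; exact: path_in_edge.
have [rpq|] := boolP (r \in [:: p; q]).
  by apply: (share _ _ _ _ r) => //; rewrite mem_head.
have [spq|] := boolP (s \in [:: p; q]).
  by move=> _; apply: (share _ _ _ _ s) => //; rewrite !inE eqxx orbT.
rewrite !inE !negb_or => /andP[sp sq] /andP[rp rq].
have prm := top_two_linked pq mqp top rp rq sp sq rs pqm rsm.
have pr : p != r by rewrite eq_sym.
transitivity (c p r).
  by apply: (share _ _ _ _ r) => //; rewrite !inE eqxx ?orbT.
by apply: (share _ _ _ _ p) => //; rewrite !inE eqxx ?orbT.
Qed.

(** * Gluing quotients over the edges *)

Section Gluing.
Variables (A : fieldType) (u : 'I_n -> {poly A}).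
Hypotheses (u0 : forall k, u k != 0) (u00 : forall k, (u k)`_0 = 0).

(** Exponents of the sum of the two ideals: a minimum in which 0 is read as infinity. *)
Definition joinpow (a b : 'I_n -> nat) k : nat :=
  if a k == 0%N then b k else if b k == 0%N then a k else minn (a k) (b k).

Lemma purepow_join a b m : purepow (joinpow a b) m = purepow a m || purepow b m.
Proof.
apply/existsP/orP => [[k]|[]/existsP[k ak]]; last 2 first.
- by exists k; move: ak; rewrite /joinpow; case: (a k =P 0%N) => ?; case: (b k =P 0%N) => ?; lia.
- by exists k; move: ak; rewrite /joinpow; case: (a k =P 0%N) => ?; case: (b k =P 0%N) => ?; lia.
rewrite /joinpow; case: eqP => ak; first by right; apply/existsP; exists k.
case: eqP => bk; first by left; apply/existsP; exists k.
have [ab|ba] := leqP (a k) (b k) => h; [left|right]; apply/existsP; exists k; lia.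
Qed.

Lemma mpoly_of_coeffs (s : seq 'X_{1..n}) (c : 'X_{1..n} -> A) :
  (forall m, m \notin s -> c m = 0) -> exists z : {mpoly A[n]}, forall m, z@_m = c m.
Proof.
move=> c0; exists (\sum_(m <- undup s) c m *: 'X_[m]) => m; rewrite raddf_sum /=.
have [ms|ms] := boolP (m \in s); last first.
  rewrite c0 // big_seq big1 // => m'; rewrite mem_undup => m's.
  by rewrite mcoeffZ mcoeffX (negbTE (memPn ms _ m's)) mulr0.
rewrite (bigD1_seq m) ?mem_undup ?undup_uniq //= mcoeffZ mcoeffX eqxx mulr1.
by rewrite big1 ?addr0 // => m' /negbTE m'm; rewrite mcoeffZ mcoeffX m'm mulr0.
Qed.

Lemma mon_in_path (x : {mpoly A[n]}) : (1 < n)%N ->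
  (forall p q, p != q -> mon_in (purepow (edgepow p q)) x) -> mon_in pathexp x.
Proof.
move=> n1 xe m mx; apply: contrapT => nopath.
have [p [q [pq mqp top]]] := top_two m n1.
by have := top_two_notin pq mqp top nopath; rewrite (xe p q pq m mx).
Qed.

(** Quotients of [x] by [f] modulo the components are glued coefficient by coefficient: at [m], take
    the coefficient from any edge whose component misses [m]. *)
Theorem regular_pair_path : (1 < n)%N ->
  regular_pair_mod (mon_in pathexp) (usum u) (upairs u).
Proof.
move=> n1; set f := usum u; set g := upairs u.
have sub p q (x : {mpoly A[n]}) : mon_in pathexp x -> mon_in (purepow (edgepow p q)) x.
  by move=> xp m /xp/path_in_edge.
have ep p q := edgepow_eq0 p q.
have reg p q : p != q -> regular_pair_mod (mon_in (purepow (edgepow p q))) f g.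
  move=> pq; case: (ltngtP p q) => [lt|lt|/val_inj e]; last by rewrite e eqxx in pq.
    exact: regular_pair_purepow u0 u00 _ p q lt (ep p q).
  apply: (regular_pair_purepow u0 u00 (p := q) (q := p)) => // k.
  by rewrite ep orbC.
split=> [x xe|x y xy].
  by apply: (mon_in_path n1) => p q pq; have [r _] := reg p q pq; exact/r/sub/xe.
have [N NP] : exists N, forall p q, p != q ->
    mon_in (purepow (edgepow p q)) (x - f * N p q).
  have ex (e : 'I_n * 'I_n) : exists z, e.1 != e.2 ->
      mon_in (purepow (edgepow e.1 e.2)) (x - f * z).
    have [e12|] := boolP (e.1 != e.2); last by exists 0.
    by have [_ /(_ x y (sub _ _ _ xy))[z ez]] := reg _ _ e12; exists z.
  have [N NP] := choice ex; exists (fun p q => N (p, q)) => p q; exact: NP (p, q).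
(* For edges sharing [v], the difference of the quotients is killed by [f] modulo the sum of the two
   components. That sum contains no power of [X_v], so [f] is regular modulo it. [linked_const]
   extends the agreement to all edges whose components miss [m]. *)
have agree m p q r s : p != q -> r != s ->
    ~~ purepow (edgepow p q) m -> ~~ purepow (edgepow r s) m ->
    (N p q)@_m = (N r s)@_m.
  move: p q r s; apply: (@linked_const _ m (fun p q => (N p q)@_m)) => //.
  move=> p q r s v pq rs vpq vrs pqm rsm.
  pose a := joinpow (edgepow p q) (edgepow r s).
  have av : a v = 0%N.
    move: vpq vrs; rewrite !inE -!edgepow_eq0 => /eqP e1 /eqP e2.
    by rewrite /a /joinpow e1 e2.
  have subl z : mon_in (purepow (edgepow p q)) z -> mon_in (purepow a) z.
    by move=> zp l /zp; rewrite purepow_join => ->.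
  have subr z : mon_in (purepow (edgepow r s)) z -> mon_in (purepow a) z.
    by move=> zp l /zp; rewrite purepow_join orbC => ->.
  have na : ~ purepow a m by rewrite purepow_join (negbTE pqm) (negbTE rsm).
  have /mon_inP/(_ m na) : mon_in (purepow a) (N p q - N r s).
    apply: (usum_regular u0 u00 av).
    have -> : usum u * (N p q - N r s) = (x - f * N r s) - (x - f * N p q).
      by rewrite /f; ring.
    by apply: (ideal_likeB (purepow_ideal A a)); [exact/subr/NP | exact/subl/NP].
  by rewrite mcoeffB => /eqP; rewrite subr_eq0 => /eqP.
pose edge_at m : 'I_n * 'I_n -> Prop :=
  fun e => e.1 != e.2 /\ ~~ purepow (edgepow e.1 e.2) m.
have [c cP] : exists c : 'X_{1..n} -> A, (forall m p q, edge_at m (p, q) -> c m = (N p q)@_m)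
    /\ (forall m, ~ (exists e, edge_at m e) -> c m = 0).
  have ex m : exists a : A, (forall p q, edge_at m (p, q) -> a = (N p q)@_m)
      /\ (~ (exists e, edge_at m e) -> a = 0).
    have [[[p q] [pq pqm]]|no] := pselect (exists e, edge_at m e); last first.
      by exists 0; split=> // p q e; case: no; exists (p, q).
    exists (N p q)@_m; split=> [r s [rs rsm]|[]]; last by exists (p, q).
    exact: agree.
  by have [c cP] := choice ex; exists c; split=> m; have [] := cP m.
have [cN c0] := cP.
pose supp := flatten [seq msupp (N e.1 e.2) | e : 'I_n * 'I_n].
have [z zP] : exists z : {mpoly A[n]}, forall m, z@_m = c m.
  apply: (@mpoly_of_coeffs supp) => m ms.
  have [[[p q] e]|/c0//] := pselect (exists e, edge_at m e).
  rewrite (cN _ _ _ e); apply/eqP; rewrite mcoeff_eq0; apply: contra ms => mN.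
  by apply/flatten_mapP; exists (p, q) => //; rewrite mem_enum.
exists z; apply: (mon_in_path n1) => p q pq.
have idpq := purepow_ideal A (edgepow p q).
have -> : x - f * z = (x - f * N p q) - f * (z - N p q) by ring.
apply: (ideal_likeB idpq); first exact: NP.
apply: (ideal_likeM _ idpq); apply/mon_inP => m /negP pqm.
by rewrite mcoeffB zP (cN m p q) ?subrr.
Qed.

End Gluing.

End Ultrametric.

(** * Maximal ideals *)

Section WeakNullstellensatz.
Variables (A : fieldType) (K : comNzRingType) (rho : {rmorphism {poly A} -> K}) (y : K).
Hypothesis gen : forall t : K, exists F, t = (map_poly rho F).[y].
Hypothesis inv : forall t : K, t != 0 -> exists v, v * t = 1.

(* If [rho] were injective, K would be integral over [A[x][1/c]] for some nonzero [c],
   and then [1 + x c] would be a unit of [A[x][1/c]]. *)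
Lemma weak_nullstellensatz : exists2 h : {poly A}, h != 0 & rho h = 0.
Proof.
apply: contrapT => noh.
have inj h : rho h = 0 -> h = 0.
  by move=> e; apply/eqP; apply: contrapT => /negP h0; apply: noh; exists h.
have nz h : h != 0 -> rho h != 0 by apply: contra => /eqP/inj->.
(* The class of ['X] has an inverse of the form [G] at [y], so ['X%:P * G - 1] vanishes at [y]; its
   lowest coefficient is -1. *)
have [F F0 Fy] : exists2 F : {poly {poly A}}, F != 0 & (map_poly rho F).[y] = 0.
  have [v vX] := inv (nz 'X (negbT (polyX_eq0 _))); have [G vG] := gen v.
  exists ('X%:P * G - 1).
    apply: contraTneq isT => /(congr1 (fun P : {poly {poly A}} => P`_0`_0)).
    rewrite coefB coefCM coef1 coefB coefXM coef1 !coef0 /= sub0r => /eqP.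
    by rewrite oppr_eq0 oner_eq0.
  rewrite rmorphB rmorphM rmorph1 /= map_polyC !hornerE -vG mulrC vX; exact: subrr.
pose c := lead_coef F; have c0 : c != 0 by rewrite lead_coef_eq0.
have [v vc] := inv (nz _ c0).
(* [phi] sends the outer variable to the inverse [v] of [rho c], so its image is A[x][1/c], over
   which [y] is integral. *)
have [phi phiE] : exists phi : {rmorphism {poly {poly A}} -> K},
    forall b, phi b = (map_poly rho b).[v] by exists (horner_eval v \o map_poly rho).
have phiC e : phi e%:P = rho e by rewrite phiE /= map_polyC hornerC.
have phiX : phi 'X = v by rewrite phiE /= map_polyX hornerX.
have int_rho e : integralOver phi (rho e) by rewrite -phiC; exact: integral_id.
have int_v : integralOver phi v by rewrite -[X in integralOver _ X]phiX; exact: integral_id.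
have int_y : integralOver phi y.
  apply: (@integral_root_monic _ _ phi y (v *: map_poly rho F)).
  - have pd : (v *: map_poly rho F)`_(size F).-1 = 1 by rewrite coefZ coef_map.
    rewrite monicE lead_coefE; suff -> : size (v *: map_poly rho F) = size F by rewrite pd.
    apply/eqP; rewrite eqn_leq (leq_trans (size_scale_leq _ _)) ?size_poly //=.
    rewrite -[X in (X <= _)%N]prednK ?size_poly_gt0 // ltnNge; apply/negP => le.
    by move: pd; rewrite nth_default // => /eqP; rewrite eq_sym oner_eq0.
  - by rewrite /root hornerZ Fy mulr0.
  - apply/integral_poly => i; rewrite coefZ coef_map; apply: integral_mul; [exact: int_v | exact: int_rho].
pose h := 1 + 'X * c.
have hc : coprimep h c.
  apply/Bezout_coprimepP; exists (1, - 'X) => /=.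
  by rewrite /h mul1r mulNr addrK eqpxx.
have szh : (1 < size h)%N.
  have sX : size ('X * c) = (size c).+1 by rewrite mulrC size_mulX.
  by rewrite /h addrC size_polyDl sX ?size_poly1 ltnS size_poly_gt0.
have h0 : h != 0 by rewrite -size_poly_gt0 ltnW.
have [z zh] := inv (nz _ h0).
(* The inverse [z] of [rho h] is integral over the image of [phi]; multiplying its monic equation by
   a power of [rho h] gives [1 + rho h * phi beta = 0]. *)
have [P monP /rootP Pz] : integralOver phi z.
  have [G ->] := gen z; apply: integral_horner int_y => e /(nthP 0)[i _ <-].
  by rewrite coef_map; exact: int_rho.
pose m := (size P).-1.
pose beta := \sum_(i < m) P`_i * h%:P ^+ (m - i).-1.
have e1 : 1 + rho h * phi beta = 0.
  have : rho h ^+ m * (map_poly phi P).[z] = 0 by rewrite Pz mulr0.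
  have szP : (size (map_poly phi P) <= size P)%N := size_poly _ _.
  rewrite (horner_coef_wide _ szP) -[size P]prednK; last first.
    by rewrite size_poly_gt0 monic_neq0.
  have zhX k : z ^+ k * rho h ^+ k = 1 by rewrite -exprMn zh expr1n.
  rewrite -/m big_ord_recr /= coef_map -lead_coefE (monicP monP) /= rmorph1 mul1r.
  rewrite mulrDr [X in _ + X]mulrC zhX addrC => <-; congr (_ + _).
  rewrite /beta rmorph_sum !mulr_sumr; apply: eq_bigr => i _.
  rewrite rmorphM rmorphXn phiC coef_map /= mulrCA -exprS prednK ?subn_gt0 //.
  rewrite [RHS]mulrCA; congr (_ * _).
  have -> : rho h ^+ m = rho h ^+ (m - i) * rho h ^+ i by rewrite -exprD subnK // ltnW.
  by rewrite -mulrA [rho h ^+ i * _]mulrC zhX mulr1.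
(* Clearing the powers of [1/c] in [phi beta] yields [c ^+ N = - (h * e)], against the coprimality
   of [h] and [c]. *)
have [N [e eN]] : exists N e, rho c ^+ N * phi beta = rho e.
  exists (size beta); exists (\sum_(i < size beta) beta`_i * c ^+ (size beta - i)).
  have szb : (size (map_poly rho beta) <= size beta)%N := size_poly _ _.
  rewrite phiE (horner_coef_wide _ szb) mulr_sumr (rmorph_sum rho).
  apply: eq_bigr => i _; rewrite coef_map rmorphM rmorphXn /= mulrCA; congr (_ * _).
  have -> : rho c ^+ size beta = rho c ^+ (size beta - i) * rho c ^+ i.
    by rewrite -exprD subnK // ltnW.
  by rewrite -mulrA -exprMn [rho c * v]mulrC vc expr1n mulr1.
have : rho (c ^+ N + h * e) = 0.
  rewrite rmorphD rmorphM rmorphXn -eN mulrCA -[X in X + _]mulr1 -mulrDr e1; exact: mulr0.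
move=> /inj/eqP; rewrite addr_eq0 => /eqP cN.
have : h %| c ^+ N by rewrite cN dvdpNr dvdp_mulr.
have hcN : coprimep h (c ^+ N) by apply: coprimep_expr.
move=> /dvdp_gcd_idl /eqp_size e2; move: hcN szh; rewrite coprimep_def => /eqP.
by rewrite -e2 => ->.
Qed.

End WeakNullstellensatz.

Lemma mpoly_hom_ext (R : comNzRingType) n (B : comNzRingType)
    (f g : {rmorphism {mpoly R[n]} -> B}) :
  (forall c, f c%:MP = g c%:MP) -> (forall k, f 'X_k = g 'X_k) -> f =1 g.
Proof.
move=> fgC fgX p; rewrite [p]mpolyE !rmorph_sum; apply: eq_bigr => m _.
rewrite -mul_mpolyC !rmorphM fgC mpolyXE_id !rmorph_prod; congr (_ * _).
by apply: eq_bigr => k _; rewrite !rmorphXn fgX.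
Qed.

Lemma poly_mul_eq0 (K : comNzRingType) (F G : {poly K}) :
  (forall a b : K, a * b = 0 -> a = 0 \/ b = 0) -> F * G = 0 -> F = 0 \/ G = 0.
Proof.
move=> dom FG; have [->|F0] := eqVneq F 0; first by left.
have [->|G0] := eqVneq G 0; first by right.
have nz : lead_coef F * lead_coef G != 0.
  by apply/eqP => /dom[]/eqP; rewrite lead_coef_eq0; apply/negP.
by move: (lead_coef_proper_mul nz); rewrite FG lead_coef0 => e; rewrite -e eqxx in nz.
Qed.

Section IdealOfPred.
Variables (R : comNzRingType) (I : {pred R}).
Hypothesis idI : idealr_closed I.

(** The proof is carried as an argument so that the ideal structure can be attached to an arbitrary
    predicate. *)
Definition pred_of_ideal of idealr_closed I : {pred R} := I.
HB.instance Definition _ := isIdealr.Build R (pred_of_ideal idI) idI.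

Lemma quotient_map : exists (K : comNzRingType) (pi : {rmorphism R -> K}),
  (forall x, pi x = 0 <-> x \in I) /\ (forall t, exists x, t = pi x).
Proof.
pose J : idealr R := pred_of_ideal idI.
exists {ideal_quot J}, \pi_({ideal_quot J}); split=> [x|t]; first exact: pi_ideal_eq0.
by elim/quotW: t => x; exists x.
Qed.

End IdealOfPred.

Lemma kernel_prime (R K : comNzRingType) (f : {rmorphism R -> K}) :
  (forall a b : K, a * b = 0 -> a = 0 \/ b = 0) ->
  prime_ideal (fun x => `[< f x = 0 >]).
Proof.
move=> dom; split; first split.
- by apply/asboolP; rewrite rmorph0.
- by apply/asboolP; rewrite rmorph1 => /eqP; rewrite oner_eq0.
- by move=> a x y /asboolP x0 /asboolP y0; apply/asboolP; rewrite rmorphD rmorphM x0 y0 mulr0 addr0.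
- move=> x y /asboolP; rewrite rmorphM => /dom[] e; apply/orP; [left|right]; exact/asboolP.
Qed.

Section MaximalIdeals.
Variables (A : fieldType) (n : nat) (M : {pred {mpoly A[n]}}) (p q : 'I_n).
Hypotheses (prM : prime_ideal M) (maxM : forall y, y \notin M -> exists z, 1 - z * y \in M).
Hypothesis (Mvar : forall k, k != p -> k != q -> 'X_k \in M).

Definition plane_exp (p q k : 'I_n) : nat := (k != p) && (k != q).

Lemma plane_exp_le1 p' q' k : (plane_exp p' q' k <= 1)%N.
Proof. exact: leq_b1. Qed.

Lemma plane_exp_eq0 p' q' k : (plane_exp p' q' k == 0%N) = (k == p') || (k == q').
Proof. by rewrite /plane_exp; case: (k == p') => //=; case: (k == q'). Qed.

(** Modulo [M] all variables but [X_p] and [X_q] vanish, so the residue ring is generated by the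
    class of [X_q] over the image of A[X_p], and [maxM] makes its nonzero elements invertible. *)
Lemma nullstellensatz_var : exists2 h : {poly A}, h != 0 & pvar h p \in M.
Proof.
have [K [pi [piM pi_surj]]] := quotient_map prM.1.
have [rho rhoE] : exists rho : {rmorphism {poly A} -> K}, forall h, rho h = pi (pvar h p).
  by exists (pi \o horner_eval 'X_p \o map_poly (@mpolyC n A)).
have [h h0 rh] : exists2 h : {poly A}, h != 0 & rho h = 0; last first.
  by exists h => //; apply/piM; rewrite -rhoE.
apply: (@weak_nullstellensatz _ _ rho (pi 'X_q)) => t; have [x ->] := pi_surj t.
  pose F (k : 'I_n) : {poly {poly A}} := if k == p then 'X%:P else 'X.
  pose G : {rmorphism {mpoly A[n]} -> {poly {poly A}}} :=
    kill (plane_exp p q) (@polyC {poly A} \o @polyC A) F.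
  exists (G x).
  have [ev evE] : exists ev : {rmorphism {poly {poly A}} -> K},
      forall b, ev b = (map_poly rho b).[pi 'X_q].
    by exists (horner_eval (pi 'X_q) \o map_poly rho).
  rewrite -evE; apply: (@mpoly_hom_ext _ _ _ pi (ev \o G)) => [c|k] /=.
    by rewrite killC evE /= map_polyC hornerC /= rhoE /pvar map_polyC hornerC.
  rewrite killX plane_exp_eq0 /F; have [->|kp] /= := eqVneq k p.
    by rewrite evE map_polyC hornerC /= rhoE /pvar map_polyX hornerX.
  have [->|kq] := eqVneq k q; first by rewrite evE map_polyX hornerX.
  by rewrite rmorph0; apply/piM/Mvar.
move=> x0; have [|z zx] := maxM (y := x).
  by apply: contra x0 => /piM->.
exists (pi z); apply/eqP; rewrite -rmorphM eq_sym -subr_eq0 -(rmorph1 pi) -rmorphB.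
exact/eqP/piM.
Qed.

End MaximalIdeals.

(** * Chains of primes of length two *)

Section PlaneChain.
Variables (A : fieldType) (n : nat) (M : {pred {mpoly A[n]}}) (p q : 'I_n).
Hypotheses (prM : prime_ideal M) (maxM : forall y, y \notin M -> exists z, 1 - z * y \in M).
Hypotheses (pq : p != q) (Mvar : forall k, k != p -> k != q -> 'X_k \in M).

Lemma purepow_prime (b : 'I_n -> nat) : (forall k, b k <= 1)%N ->
  prime_ideal (fun x : {mpoly A[n]} => `[< mon_in (purepow b) x >]).
Proof.
move=> b1.
have -> : (fun x : {mpoly A[n]} => `[< mon_in (purepow b) x >]) =
    (fun x => `[< kill b (@mpolyC n A) (fun k => 'X_k) x = 0 >]).
  by apply/funext => x; apply/asboolP/asboolP => /(kill_self_eq0 b1).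
apply: kernel_prime => x y /eqP; rewrite mulf_eq0 => /orP[] /eqP; by [left | right].
Qed.

(** The middle prime is the kernel of the map to K[Y], with [K] the residue ring at [M], sending
    [X_p] to its class, [X_q] to Y and the other variables to 0. The relations [hp] and [hq] make
    both inclusions strict. *)
Lemma plane_chain : exists P : 'I_3 -> {pred {mpoly A[n]}},
  [/\ prime_chain P, P ord0 = (fun x => `[< mon_in (purepow (plane_exp p q)) x >])
    & forall i, {subset P i <= M}].
Proof.
have [hp hp0 hpM] := nullstellensatz_var prM maxM Mvar.
have [hq hq0 hqM] : exists2 h : {poly A}, h != 0 & pvar h q \in M.
  by apply: (nullstellensatz_var prM maxM (q := p)) => k kq kp; exact: Mvar.
have [K [pi [piM pi_surj]]] := quotient_map prM.1.
have domK (a b : K) : a * b = 0 -> a = 0 \/ b = 0.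
  have [x ->] := pi_surj a; have [y ->] := pi_surj b.
  rewrite -rmorphM => /piM; rewrite prime_idealM // => /orP[] /piM; by [left | right].
have [phi phiE] : exists phi : {rmorphism A -> {poly K}}, forall c, phi c = (pi c%:MP)%:P.
  by exists (@polyC K \o pi \o @mpolyC n A).
have [f fE] : exists f : {rmorphism {mpoly A[n]} -> {poly K}},
    f =1 kill (plane_exp p q) phi (fun k => if k == p then (pi 'X_p)%:P else 'X).
  by exists (kill (plane_exp p q) phi (fun k => if k == p then (pi 'X_p)%:P else 'X)).
have ple := plane_exp_le1 p q.
have fp h : f (pvar h p) = (pi (pvar h p))%:P.
  rewrite fE kill_pvar plane_exp_eq0 eqxx (rmorph_pvar pi h p).
  rewrite -[RHS](horner_map (@polyC K)) -[in RHS]map_poly_comp.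
  by congr (_.[_]); apply: eq_map_poly => c; exact: phiE.
have qp : (q == p) = false by rewrite eq_sym; exact: negbTE.
have fq h : f (pvar h q) = map_poly (pi \o @mpolyC n A) h.
  rewrite fE kill_pvar plane_exp_eq0 eqxx orbT qp.
  rewrite (eq_map_poly (g := @polyC K \o (pi \o @mpolyC n A))) => [|c]; last by rewrite phiE.
  by rewrite (map_poly_comp (@polyC K) (pi \o @mpolyC n A)) -/(_ \Po _) comp_polyXr.
have fev x : (f x).[pi 'X_q] = pi x.
  apply: (@mpoly_hom_ext _ _ _ (horner_eval (pi 'X_q) \o f) pi) => [c|k] /=.
    by rewrite fE killC phiE /horner_eval hornerC.
  rewrite fE killX plane_exp_eq0 /horner_eval; have [->|kp] /= := eqVneq k p.
    by rewrite hornerC.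
  have [->|kq] := eqVneq k q; first by rewrite hornerX.
  by rewrite horner0; apply/esym/piM/Mvar.
pose P0 : {pred {mpoly A[n]}} := fun x => `[< mon_in (purepow (plane_exp p q)) x >].
pose P1 : {pred {mpoly A[n]}} := fun x => `[< f x = 0 >].
pose P (i : 'I_3) : {pred {mpoly A[n]}} := if val i is j.+1 then if j is _.+1 then M else P1 else P0.
have prP0 : prime_ideal P0 by exact: purepow_prime.
have prP1 : prime_ideal P1 by apply: kernel_prime => F G; exact: poly_mul_eq0.
have P01 : {subset P0 <= P1} by move=> x /asboolP xP; apply/asboolP; rewrite fE kill_eq0.
have P1M : {subset P1 <= M} by move=> x /asboolP fx; apply/piM; rewrite -fev fx horner0.
have s01 : exists2 x, x \in P1 & x \notin P0.
  exists (pvar hp p).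
    by apply/asboolP; rewrite fp; have /piM-> := hpM.
  apply/asboolP => /(kill_eq0 (@polyC A) (fun=> 'X) ple).
  by rewrite kill_pvar plane_exp_eq0 eqxx -/(_ \Po _) comp_polyXr => /eqP; apply/negP.
have s1M : exists2 x, x \in M & x \notin P1.
  exists (pvar hq q) => //; apply/asboolP; rewrite fq => e; case/eqP: hq0.
  apply/polyP => i; rewrite coef0; have := congr1 (fun g : {poly K} => g`_i) e.
  rewrite /= coef_map coef0 /= => /piM cM; apply/eqP; apply: contraT => c0.
  have : 1 \in M.
    rewrite -(mpolyC1 n A) -(mulVf c0) rmorphM /=; apply: idealrM cM; exact: prM.1.
  by case: prM => -[_ /negP].
exists P; split=> //; last first.
  case=> [[|[|[|i]]] i3] x //.
    by move=> /(P01 x)/(P1M x).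
  by move=> /(P1M x).
split=> [[[|[|[|i]]] i3]|[[|[|[|i]]] i3] [[|[|[|j]]] j3]] //= _.
split; first by move=> x /P01/P1M.
by have [x xM xP1] := s1M; exists x => //; apply: contra xP1; exact: P01.
Qed.

End PlaneChain.

(** * Sufficiency *)

Section Clique.
Variables (A : fieldType) (n : nat) (G : wgraph n).
Hypothesis cliqueG : is_clique G.
Notation w := (weight G).

Lemma clique_sym i j : i != j -> w i j = w j i.
Proof. by move=> ij; apply/weight_sym/cliqueG. Qed.

Lemma clique_gt0 i j : i != j -> (0 < w i j)%N.
Proof. by move=> ij; apply/weight_gt0/cliqueG. Qed.

Lemma mem_path2_ideal (x : {mpoly A[n]}) : x \in I2 A G <-> mon_in (pathexp w) x.
Proof.
have up : upclosed (pathexp w).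
  move=> m m' [i [j [k [ij jk ik [wi wj wk]]]]]; exists i, j, k; split=> //.
  by rewrite !mnmDE !(leq_trans _ (leq_addr _ _)).
have genE i j k : 'X_i ^+ w i j * 'X_j ^+ maxn (w i j) (w j k) * 'X_k ^+ w j k =
    'X_[U_(i) *+ w i j + U_(j) *+ maxn (w i j) (w j k) + U_(k) *+ w j k] :> {mpoly A[n]}.
  by rewrite !mpolyXD !mpolyXn.
split=> [/asboolP[s sG ->]|xp].
  have [U0 Ulin] := mon_in_ideal A up.
  elim: s sG => [|c s IHs] sG; first by rewrite big_nil.
  rewrite big_cons; apply: Ulin; last by apply: IHs => d ds; apply: sG; rewrite inE ds orbT.
  have [i [j [k [[ij jk ik _ _] ->]]]] := sG c (mem_head _ _).
  rewrite genE => m; rewrite msuppX inE => /eqP->; exists i, j, k; split=> //.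
  rewrite !mnmDE !mulmnE !mnm1E !eqxx !mul1n.
  by split; [rewrite -addnA leq_addr | rewrite addnAC leq_addl | rewrite leq_addl].
apply/asboolP; rewrite [x]mpolyE big_seq; apply: span_sum => m /xp.
move=> [i [j [k [ij jk ik [wi wj wk]]]]].
have im : (U_(i) *+ w i j + U_(j) *+ maxn (w i j) (w j k) + U_(k) *+ w j k <= m)%MM.
  apply/mnm_lepP => l; rewrite !mnmDE !mulmnE !mnm1E.
  have [<-|il] := eqVneq i l.
    by rewrite mul1n [j == i]eq_sym [k == i]eq_sym (negbTE ij) (negbTE ik) !mul0n !addn0.
  have [<-|jl] := eqVneq j l; last have [<-|kl] := eqVneq k l.
  - by rewrite mul1n [k == j]eq_sym (negbTE jk) !mul0n addn0.
  - by rewrite mul1n !mul0n.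
  - by rewrite !mul0n.
rewrite -(submK im) mpolyXD -mul_mpolyC mulrA; apply/spanM/span_gen.
exists i, j, k; rewrite genE; split=> //.
by split=> //; exact: cliqueG.
Qed.

Lemma path_in_prime (m : 'X_{1..n}) p q : pathexp w m -> purepow (plane_exp p q) m.
Proof.
move=> [i [j [k [ij jk ik [wi wj wk]]]]].
have mi : (0 < m i)%N by rewrite (leq_trans _ wi) ?clique_gt0.
have mk : (0 < m k)%N by rewrite (leq_trans _ wk) ?clique_gt0.
have mj : (0 < m j)%N.
  by rewrite (leq_trans _ wj) // leq_max clique_gt0.
have out l : (0 < m l)%N -> (l != p) && (l != q) -> purepow (plane_exp p q) m.
  by move=> ml lpq; apply/existsP; exists l; rewrite /plane_exp lpq.
apply: contraT => no; move: ij jk ik.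
have inpq l : (0 < m l)%N -> (l == p) || (l == q).
  move=> ml; apply: contraT; rewrite negb_or => /(out l ml) h; by rewrite h in no.
case/orP: (inpq i mi) => /eqP->; case/orP: (inpq j mj) => /eqP->;
  case/orP: (inpq k mk) => /eqP->; by rewrite ?eqxx.
Qed.

Section Sufficiency.
Hypotheses (n1 : (1 < n)%N) (ultra : reverse_ultrametric w).

(** The uniform bound for counting monomials: outside the ideal, all exponents but the two largest
    stay below the largest weight. *)
Let notpath_bound (m : 'X_{1..n}) : ~ pathexp w m -> exists i j : 'I_n,
  forall k, k != i -> k != j -> (m k < \max_i \max_j w i j)%N.
Proof.
have [p [q [pq mqp top]]] := top_two m n1.
move=> /(top_two_notin clique_sym clique_gt0 ultra pq mqp top)/(notin_edgeP clique_gt0) lt.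
exists p, q => k kp kq; have [mk _] := lt k kp kq; apply: leq_trans mk _.
apply: leq_trans (leq_bigmax p); exact: (leq_bigmax (F := fun j => w p j) k).
Qed.

Section AtMaximal.
Variables (T : comNzRingType) (M : {pred {mpoly A[n]}}).
Variable psi : {rmorphism {mpoly A[n]} -> T}.
Hypotheses (loc : localizes (I2 A G) M psi).
Hypothesis (maxM : forall y, y \notin M -> exists z, 1 - z * y \in M).

Let prM : prime_ideal M := localizes_prime loc.

(** The prime [M] contains every generator, hence one variable out of any three; at most two
    variables lie outside it. *)
Lemma maximal_contains_plane : exists p q : 'I_n, p != q /\
  forall k, k != p -> k != q -> 'X_k \in M.
Proof.
have triple i j k : i != j -> j != k -> i != k ->
    [|| 'X_i \in M, 'X_j \in M | 'X_k \in M].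
  move=> ij jk ik.
  have : 'X_i ^+ w i j * 'X_j ^+ maxn (w i j) (w j k) * 'X_k ^+ w j k \in M.
    apply: (localizes_sub loc); apply/asboolP/span_gen.
    by exists i, j, k; split=> //; split=> //; exact: cliqueG.
  rewrite !prime_idealM // => /orP[/orP[]|] /(prime_idealX prM) ->; by rewrite ?orbT.
have other (p : 'I_n) : exists q, p != q.
  have [<-|] := eqVneq (Ordinal n1) p; last by exists (Ordinal n1); rewrite eq_sym.
  by exists (Ordinal (ltnW n1)).
have [/existsP[p pM]|allM] := boolP [exists p, 'X_p \notin M]; last first.
  have [q pq] := other (Ordinal n1); exists (Ordinal n1), q; split=> // k _ _.
  by apply: contraT => kM; case/existsP: allM; exists k.
have [/existsP[q /andP[pq qM]]|allM] := boolP [exists q, (p != q) && ('X_q \notin M)].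
  exists p, q; split=> // k kp kq; have := triple k p q kp pq kq.
  by rewrite (negbTE pM) (negbTE qM) !orbF.
have [q pq] := other p; exists p, q; split=> // k kp _.
by apply: contraT => kM; case/existsP: allM; exists k; rewrite eq_sym kp.
Qed.

Lemma maximal_regular_pair : exists f g, [/\ f \in M, g \in M &
  regular_pair_mod (fun x => x \in I2 A G) f g].
Proof.
have [p [q [pq Mvar]]] := maximal_contains_plane.
have ex k : exists h : {poly A}, h != 0 /\ pvar h k \in M.
  have [->|kp] := eqVneq k p.
    by have [h h0 hM] := nullstellensatz_var prM maxM Mvar; exists h.
  have [->|kq] := eqVneq k q.
    have [|h h0 hM] := nullstellensatz_var prM maxM (p := q) (q := p).
      by move=> l lq lp; exact: Mvar.
    by exists h.
  by exists 'X; rewrite polyX_eq0 /pvar map_polyX hornerX; split=> //; exact: Mvar.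
(* The factor ['X] removes the constant term of [u k] while its value at ['X_k] stays in [M]. *)
have [h hM] := choice ex; pose u k := 'X * h k.
have u0 k : u k != 0 by rewrite mulf_neq0 ?polyX_eq0 //; have [] := hM k.
have u00 k : (u k)`_0 = 0 by rewrite coefXM.
have uM k : pvar (u k) k \in M.
  rewrite /pvar rmorphM /= hornerM -/(pvar _ _) idealrM //; first exact: prM.1.
  by have [] := hM k.
exists (usum u), (upairs u); split.
- by apply: idealr_sum => //; exact: prM.1.
- apply: idealr_sum => [|i _]; first exact: prM.1.
  apply: idealr_sum => [|j _]; first exact: prM.1.
  by apply: idealrM => //; exact: prM.1.
have [r1 r2] := regular_pair_path clique_sym clique_gt0 ultra u0 u00 n1.
split=> [x /mem_path2_ideal/r1/mem_path2_ideal//|x y /mem_path2_ideal/r2[z zP]].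
by exists z; apply/mem_path2_ideal.
Qed.

Lemma cohen_macaulay_at : cohen_macaulay_local T.
Proof.
have [f [g [fM gM [r1 r2]]]] := maximal_regular_pair.
have [p [q [pq Mvar]]] := maximal_contains_plane.
have [P [chP P0 PM]] := plane_chain prM maxM pq Mvar.
have UI x : (forall m, m \in msupp x -> pathexp w m) -> x \in I2 A G.
  by move=> xp; apply/mem_path2_ideal.
have memE x : (psi x \in extended M psi M) = (x \in M).
  by apply: (mem_extended loc prM (localizes_sub loc)).
apply: (cohen_macaulay_local_intro (extended_local loc) (d := 2)).
- exists (extended M psi \o P); apply: (extended_chain loc chP _ PM) => i x xI.
  have x0 : x \in P ord0.
    by rewrite P0; apply/asboolP => m mx; apply/path_in_prime/((mem_path2_ideal x).1 xI m mx).
  have [->//|i0] := eqVneq i ord0.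
  have [_ chain] := chP; have [|sub _] := chain ord0 i; first by rewrite lt0n.
  exact: sub.
- by move=> e; exact: (prime_chain_le2 loc UI notpath_bound).
- have regT1 t : psi f * t = 0 -> t = 0.
    have [s sM [x e]] := localizes_surj loc t => ft.
    have [v vs] := localizes_unit loc sM.
    suff psix : psi x = 0 by rewrite -[t]mul1r -vs -mulrA e psix mulr0.
    have /(localizes_ker loc)[s' s'M] : psi (f * x) = 0.
      by rewrite rmorphM -e mulrCA ft mulr0.
    rewrite mulrCA => /r1 xI; apply/(localizes_ker loc); by exists s'.
  have regT2 t t' : psi g * t = psi f * t' -> exists t'', t = psi f * t''.
    have [s sM [x e]] := localizes_surj loc t; have [s' s'M [y e']] := localizes_surj loc t' => gt.
    have /(localizes_ker loc)[s'' s''M] : psi (g * (s' * x) - f * (s * y)) = 0.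
      rewrite rmorphB !rmorphM -e -e'; apply/eqP; rewrite subr_eq0; apply/eqP.
      transitivity (psi s * psi s' * (psi g * t)); first by ring.
      by rewrite gt; ring.
    have -> : s'' * (g * (s' * x) - f * (s * y)) =
      g * (s'' * s' * x) - f * (s'' * s * y) by ring.
    move=> /r2[z zI].
    have ez : psi (s'' * s' * s) * t = psi f * psi z.
      rewrite 2!rmorphM -mulrA e -!rmorphM; apply/eqP; rewrite -subr_eq0 -rmorphB; apply/eqP.
      by apply/(localizes_ker loc); exists 1; rewrite ?mul1r //; case: prM => -[].
    have [|v vs] := localizes_unit loc (s := s'' * s' * s).
      by rewrite !(notin_mul loc).
    by exists (v * psi z); rewrite -[t]mul1r -vs -mulrA ez; ring.
  exists [:: psi f; psi g]; split=> //.
    by move=> t; rewrite !inE => /orP[]/eqP->; rewrite memE.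
  split=> [[|[|//]] _ t|gen1].
  + by move=> /span_nil/= /regT1->; exact: ideal_span0.
  + move=> /= /span_consP[b /span_nil/eqP]; rewrite subr_eq0 mulrC => /eqP e.
    have [|t'' ->] := regT2 t b; first by rewrite mulrC e mulrC.
    by rewrite mulrC; apply/spanM/span_gen; exact: mem_head.
  + have idE := (extended_local loc).1.1.
    have : 1 \in extended M psi M.
      apply: idealr_closed_span => //; apply: span_sub gen1 => t.
      by rewrite !inE => /orP[]/eqP->; apply: span_gen; rewrite memE.
    by case: idE => _ /negP.
- by move=> s _; exact: (regular_seq_le2 loc UI notpath_bound).
Qed.

End AtMaximal.

Theorem ultrametric_cohen_macaulay : cohen_macaulay_ideal (I2 A G).
Proof.
split; first exact/noetherian_quot/noetherian_mpoly.
move=> M [idM maxM]; apply: (cohen_macaulay_at (localizes_quot M)) => y yM.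
(* [J] is generated by [M] and the class of [y]. If it contains 1, the required [z] exists;
   otherwise it is a proper ideal and maximality puts that class in [M]. *)
pose J : {pred {ideal_quot (I2 A G)}} := fun t => `[< exists z, t - z * \pi y \in M >].
have [/asboolP[z]|J1] := boolP (1 \in J).
  rewrite -[z]reprK -rmorphM -(rmorph1 \pi_({ideal_quot (I2 A G)})) -rmorphB => zM.
  by exists (repr z).
have idJ : idealr_closed J.
  split=> [||a s t /asboolP[z zM] /asboolP[z' z'M]] //.
    by apply/asboolP; exists 0; rewrite mul0r subr0; exact: idealr0.
  apply/asboolP; exists (a * z + z').
  have -> : a * s + t - (a * z + z') * \pi y = a * (s - z * \pi y) + (t - z' * \pi y).
    by ring.
  by rewrite rpredD // idealMr.
case/negP: yM; rewrite /contracted unfold_in -(maxM J idJ).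
  by apply/asboolP; exists 1; rewrite mul1r subrr; exact: idealr0.
by move=> t tM; apply/asboolP; exists 0; rewrite mul0r subr0.
Qed.

End Sufficiency.

End Clique.

(** * Necessity *)

Section RegularPowers.
Variable T : comNzRingType.
Implicit Types (a b t : T).

(** First [b] is regular modulo every power of [a], by cancelling one factor [a] at a time; then the
    factors [b] are removed one by one. *)
Lemma regular_pair_powers a b k l :
  (forall t, a * t = 0 -> t = 0) ->
  (forall t t', b * t = a * t' -> exists t'', t = a * t'') ->
  (forall t, a ^+ k * t = 0 -> t = 0) /\
  (forall t t', b ^+ l * t = a ^+ k * t' -> exists t'', t = a ^+ k * t'').
Proof.
move=> ra rb; split.
  by elim: k => [|k IHk] t; rewrite ?expr0 ?mul1r // exprS -mulrA => /ra/IHk.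
have inj t t' : a * t = a * t' -> t = t'.
  by move=> e; apply/eqP; rewrite -subr_eq0; apply/eqP/ra; rewrite mulrBr e subrr.
have rak t t' : b * t = a ^+ k * t' -> exists t'', t = a ^+ k * t''.
  elim: k t t' => [|k IHk] t t'; first by exists t; rewrite expr0 mul1r.
  rewrite exprS -mulrA => bt; have [t1 t1E] := rb _ _ bt.
  have [|t2 t2E] := IHk t1 t'; first by apply: inj; rewrite -bt t1E mulrCA.
  by exists t2; rewrite t1E t2E mulrA -exprS.
elim: l => [|l IHl] t t'; first by rewrite expr0 mul1r; exists t'.
by rewrite exprS -mulrA => /rak[t'' /IHl].
Qed.

End RegularPowers.

Section Necessity.
Variables (A : fieldType) (n : nat) (G : wgraph n).
Hypothesis cliqueG : is_clique G.
Notation w := (weight G).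
Let w_sym := clique_sym cliqueG.
Let w_gt0 := clique_gt0 cliqueG.

Definition origin : {pred {mpoly A[n]}} := fun x => x@_0%MM == 0.

Lemma origin_purepow : origin = (fun x => `[< mon_in (purepow (fun=> 1%N)) x >]).
Proof.
have pp (m : 'X_{1..n}) : purepow (fun=> 1%N) m = (m != 0%MM).
  apply/existsP/idP => [[k mk]|m0]; first by apply: contraTneq mk => ->; rewrite mnm0E.
  apply: contrapT => nok; case/eqP: m0; apply/mnmP => k; rewrite mnm0E.
  by apply/eqP; rewrite -leqn0 leqNgt; apply/negP => mk; apply: nok; exists k.
apply/funext => x; apply/idP/asboolP => [x0 m mx|xp].
  by rewrite pp; apply: contraTneq mx => ->; rewrite mcoeff_msupp negbK.
rewrite /origin mcoeff_eq0; apply/negP => /xp; by rewrite pp eqxx.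
Qed.

Lemma origin_prime : prime_ideal origin.
Proof. by rewrite origin_purepow; exact: purepow_prime. Qed.

Lemma sub_origin x : x \in I2 A G -> x \in origin.
Proof.
move/(mem_path2_ideal cliqueG) => xp; rewrite unfold_in mcoeff_eq0; apply/negP.
move=> /xp[i [j [k [ij _ _ [wi _ _]]]]].
by move: wi; rewrite mnm0E leqNgt w_gt0.
Qed.

(** Independent of the representative because the 2-path ideal lies in [origin]. *)
Definition origin_quot : {pred {ideal_quot (I2 A G)}} := fun t => repr t \in origin.

Lemma mem_origin_quot x : (\pi_({ideal_quot (I2 A G)}) x \in origin_quot) = (x \in origin).
Proof.
have d : repr (\pi_({ideal_quot (I2 A G)}) x) - x \in origin.
  by apply: sub_origin; rewrite Quotient.idealrBE reprK.
rewrite unfold_in -/(_ \in origin).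
have id0 := origin_prime.1.
apply/idP/idP => h.
  rewrite -[x](subKr (repr (\pi_({ideal_quot (I2 A G)}) x))); exact: idealrB.
rewrite -[repr _](subrK x); exact: idealrD.
Qed.

Lemma origin_quot_closed : idealr_closed origin_quot.
Proof.
have [o0 o1 olin] := origin_prime.1; split.
- by rewrite -(rmorph0 \pi_({ideal_quot (I2 A G)})) mem_origin_quot.
- by rewrite -(rmorph1 \pi_({ideal_quot (I2 A G)})) mem_origin_quot.
- elim/quotW=> a; elim/quotW=> x; elim/quotW=> y.
  by rewrite -rmorphM -rmorphD !mem_origin_quot; exact: olin.
Qed.

Lemma origin_quot_prime : prime_idealr_closed origin_quot.
Proof.
elim/quotW=> x; elim/quotW=> y; rewrite -rmorphM !mem_origin_quot.
by rewrite (prime_idealM _ _ origin_prime).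
Qed.

HB.instance Definition _ := isIdealr.Build _ origin_quot origin_quot_closed.
HB.instance Definition _ := isPrimeIdealrClosed.Build _ origin_quot origin_quot_prime.

Lemma origin_quot_maximal : maximal_ideal origin_quot.
Proof.
split; first exact: origin_quot_closed.
move=> J idJ MJ t; apply/idP/idP; last exact: MJ.
elim/quotW: t => x xJ; rewrite mem_origin_quot; apply: contraT => x0.
pose c : {mpoly A[n]} := (x@_0%MM)%:MP.
have xc : x - c \in origin.
  by rewrite unfold_in mcoeffB mcoeffC eqxx mulr1 subrr.
have [_ /negP J1 _] := idJ; case: J1.
have cJ : \pi_({ideal_quot (I2 A G)}) c \in J.
  rewrite -[c](subKr x) rmorphB; apply: idealrB => //; apply: MJ.
  by rewrite mem_origin_quot.
have -> : 1 = \pi_({ideal_quot (I2 A G)}) ((x@_0%MM)^-1)%:MP * \pi c.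
  by rewrite -rmorphM -mpolyCM mulVf // mpolyC1 rmorph1.
exact: idealrM.
Qed.

Lemma origin_powers (x : {mpoly A[n]}) k : x \in origin ->
  forall m, m \in msupp (x ^+ k) -> (k <= mdeg m)%N.
Proof.
move=> x0; elim: k => // k IHk m; rewrite exprS.
move=> /msuppM_le/allpairsP[[m1 m2] /= [m1x /IHk m2k ->]]; rewrite mdegD -add1n leq_add //.
rewrite lt0n mdeg_eq0; apply: contraTneq m1x => ->; by rewrite mcoeff_msupp negbK.
Qed.

Lemma mon_split (U U' : pred 'X_{1..n}) (x : {mpoly A[n]}) :
  (forall m, m \in msupp x -> U m || U' m) ->
  exists y z, [/\ x = y + z, mon_in U y & mon_in U' z].
Proof.
move=> xU; exists (\sum_(m <- msupp x | U m) x@_m *: 'X_[m]).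
exists (\sum_(m <- msupp x | ~~ U m) x@_m *: 'X_[m]).
split; first by rewrite [LHS]mpolyE (bigID U).
- move=> m /msupp_sum_le/flatten_mapP[m']; rewrite mem_filter => /andP[Um' _] /msuppZ_le.
  by rewrite msuppX inE => /eqP->.
- move=> m /msupp_sum_le/flatten_mapP[m']; rewrite mem_filter => /andP[Um' m'x] /msuppZ_le.
  rewrite msuppX inE => /eqP->; by move: (xU m' m'x); rewrite (negbTE Um').
Qed.

Section BadTriple.
Variables (v1 v2 l : 'I_n).
Hypotheses (v12 : v1 != v2) (v1l : v1 != l) (v2l : v2 != l).
Hypotheses (bad1 : (w v1 v2 < w v1 l)%N) (bad2 : (w v1 v2 < w v2 l)%N).

(** [near] encodes the ideal of the [N]-th powers of [X_v1] and [X_v2], [far] that of the [N]-th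
    powers of the other variables, and [e] is the exponent of (X_v1 X_v2)^a with a the weight of
    [v1 v2]. The successor keeps [N] positive, as 0 would mean no generator. *)
Let N := (\max_i \max_j w i j).+1.
Let e : 'X_{1..n} := (U_(v1) *+ w v1 v2 + U_(v2) *+ w v1 v2)%MM.
Let near (k : 'I_n) := if (k == v1) || (k == v2) then N else 0%N.
Let far (k : 'I_n) := if (k == v1) || (k == v2) then 0%N else N.

Let wN i j : (w i j <= N)%N.
Proof.
apply: leqW; apply: leq_trans (leq_bigmax i); exact: (leq_bigmax (F := fun j => w i j) j).
Qed.

Let eE k : e k = if (k == v1) || (k == v2) then w v1 v2 else 0%N.
Proof.
rewrite /e mnmDE !mulmnE !mnm1E [v1 == k]eq_sym [v2 == k]eq_sym.
have [->|] /= := eqVneq k v1; first by rewrite (negbTE v12) mul1n mul0n addn0.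
by case: (k == v2); rewrite ?mul1n ?mul0n.
Qed.

(** Each monomial is divisible by X_v^N and X_q^N with [v] in [{v1, v2}] and [q] outside; the factor
    [e] then completes the generator of the path from the other of [v1], [v2] through [v] to [q]. *)
Lemma near_far_mem (x y : {mpoly A[n]}) : mon_in (purepow near) x ->
  mon_in (purepow far) y -> x * y * 'X_[e] \in I2 A G.
Proof.
move=> xn yf; apply/(mem_path2_ideal cliqueG) => m.
move=> /msuppM_le/allpairsP[[m' m3] /= [+ + ->]]; rewrite msuppX inE => + /eqP->.
move=> /msuppM_le/allpairsP[[m1 m2] /= [/xn/existsP[v] + /yf/existsP[q] + ->]].
rewrite /near /far; case: ifP => [vv|]; last by rewrite ltnn.
case: ifP => [|/negbT]; first by rewrite ltnn.
rewrite negb_or => /andP[q1 q2] /andP[_ Nv] /andP[_ Nq].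
have mq j : (w j q <= (m1 + m2 + e)%MM q)%N.
  by rewrite !mnmDE (leq_trans (wN _ _)) // (leq_trans Nq) // addnAC leq_addl.
have mv j j' : (maxn (w j v) (w v j') <= (m1 + m2 + e)%MM v)%N.
  by rewrite geq_max !mnmDE -addnA !(leq_trans (leq_trans (wN _ _) Nv)) ?leq_addr.
have me k : (k == v1) || (k == v2) -> (w v1 v2 <= (m1 + m2 + e)%MM k)%N.
  by move=> kv; rewrite mnmDE eE kv leq_addl.
have v21 : v2 != v1 by rewrite eq_sym.
have [q1' q2'] : v1 != q /\ v2 != q by rewrite ![_ == q]eq_sym.
case/orP: vv mv => /eqP-> mv.
- exists v2, v1, q; split=> //; split; [|exact: mv|exact: mq].
  by rewrite -w_sym // me ?eqxx ?orbT.
- exists v1, v2, q; split=> //; split; [|exact: mv|exact: mq].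
  by rewrite me ?eqxx.
Qed.

Lemma notpath_near (m : 'X_{1..n}) :
  m l = 0%N -> (forall k, k != v1 -> k != v2 -> k != l -> m k = 0%N) ->
  ~ pathexp w m.
Proof.
move=> ml mk [i [j [k [ij jk ik [wi wj wk]]]]].
have inv r s : r != s -> (w r s <= m r)%N -> (r == v1) || (r == v2).
  move=> rs wr; apply: contraT; rewrite negb_or => /andP[r1 r2].
  suff mr : m r = 0%N by have := leq_trans (w_gt0 rs) wr; rewrite mr.
  by have [->//|rl] := eqVneq r l; exact: mk.
have ji : j != i by rewrite eq_sym.
have kj : k != j by rewrite eq_sym.
have hi := inv i j ij wi.
have hk : (k == v1) || (k == v2) by apply: (inv k j kj); rewrite -(w_sym jk).
have hj : (j == v1) || (j == v2).
  by apply: (inv j i ji); rewrite -(w_sym ij) (leq_trans (leq_maxl _ _) wj).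
by move: ij jk ik; case/orP: hi => /eqP->; case/orP: hj => /eqP->; case/orP: hk => /eqP->; rewrite ?eqxx.
Qed.

(** The weights from [l] to [v1] and [v2] exceed the exponents of these two, so no admissible path
    uses [l], however large [m l] is. *)
Lemma notpath_far (m : 'X_{1..n}) : m v1 = w v1 v2 -> m v2 = w v1 v2 ->
  (forall k, k != v1 -> k != v2 -> k != l -> m k = 0%N) -> ~ pathexp w m.
Proof.
move=> m1 m2 mk [i [j [k [ij jk ik [wi wj wk]]]]].
have sup r s : r != s -> (w r s <= m r)%N -> [|| r == v1, r == v2 | r == l].
  move=> rs wr; apply: contraT; rewrite !negb_or => /and3P[r1 r2 rl].
  by have := leq_trans (w_gt0 rs) wr; rewrite mk.
have notl r s : r != s -> (w r s <= m r)%N -> (w r s <= m s)%N -> (r == v1) || (r == v2).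
  move=> rs wr ws; have := sup r s rs wr; rewrite orbA => /orP[//|/eqP rl].
  have sr : s != r by rewrite eq_sym.
  have := sup s r sr; rewrite -w_sym // => /(_ ws).
  rewrite -rl [s == r]eq_sym (negbTE rs) orbF => /orP[] /eqP sv; move: ws.
    by rewrite sv m1 rl w_sym 1?eq_sym // leqNgt bad1.
  by rewrite sv m2 rl w_sym 1?eq_sym // leqNgt bad2.
move: wj; rewrite geq_max => /andP[wj1 wj2].
have ji : j != i by rewrite eq_sym.
have kj : k != j by rewrite eq_sym.
have hi := notl i j ij wi wj1; have hj := notl j k jk wj2 wk.
have hk : (k == v1) || (k == v2) by apply: (notl k j kj); rewrite -(w_sym jk).
by move: ij jk ik; case/orP: hi => /eqP->; case/orP: hj => /eqP->; case/orP: hk => /eqP->; rewrite ?eqxx.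
Qed.

Section NotCohenMacaulay.
Variables (T : comNzRingType) (M : {pred {mpoly A[n]}}).
Variable psi : {rmorphism {mpoly A[n]} -> T}.
Hypotheses (loc : localizes (I2 A G) M psi) (originM : M =i origin).

(** Start from the ideal of all variables but [X_v1] and [X_v2], then add [X_v1] and finally [X_v2].
    This bounds the dimension below by 2. *)
Lemma origin_chain : exists P : 'I_3 -> {pred T}, prime_chain P.
Proof.
pose b (i : 'I_3) (k : 'I_n) : nat :=
  [|| (k != v1) && (k != v2), (0 < i)%N && (k == v1) | (1 < i)%N && (k == v2)].
pose P (i : 'I_3) : {pred {mpoly A[n]}} := fun x => `[< mon_in (purepow (b i)) x >].
have bmono (i j : 'I_3) m : (i <= j)%N -> purepow (b i) m -> purepow (b j) m.
  move=> ij /existsP[k bk]; apply/existsP; exists k; move: bk; rewrite /b.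
  by case: (k == v1); case: (k == v2) => //=; lia.
have varP (i : 'I_3) k : 'X_k \in P i = (0 < b i k)%N.
  apply/asboolP/idP => [/(_ U_(k)%MM)|bk m].
    rewrite msuppX mem_head => /(_ isT)/existsP[k']; rewrite mnm1E.
    by have [->|] := eqVneq k k'; lia.
  rewrite msuppX inE => /eqP->; apply/existsP; exists k.
  by rewrite mnm1E eqxx bk leq_b1.
exists (extended M psi \o P); apply: (extended_chain loc) => [|i x xI|i x /asboolP xP].
- split=> [i|i j ij]; first by apply: purepow_prime => k; exact: leq_b1.
  split=> [x /asboolP xP|].
    by apply/asboolP => m /xP; apply: bmono; exact: ltnW.
  have v21 : v2 == v1 = false by rewrite eq_sym; exact: negbTE.
  have [i0|i0] := eqVneq (i : nat) 0%N.
    exists 'X_v1; rewrite varP /b eqxx (negbTE v12); last by rewrite i0.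
    by rewrite (leq_ltn_trans (leq0n i) ij).
  have j2 := ltn_ord j; have [j1 i1] : (1 < j)%N = true /\ (1 < i)%N = false by lia.
  by exists 'X_v2; rewrite varP /b eqxx v21 ?j1 ?i1 ?andbF.
- apply/asboolP => m /((mem_path2_ideal cliqueG x).1 xI)/(path_in_prime cliqueG v1 v2).
  case/existsP=> k kp; apply/existsP; exists k; move: kp; rewrite /plane_exp /b.
  by case: ((k != v1) && (k != v2)).
- rewrite originM origin_purepow; apply/asboolP => m /xP/existsP[k bk].
  by case/andP: bk => b0 bm; apply/existsP; exists k; rewrite /= (leq_trans b0 bm).
Qed.

(** Elements of [M] have no constant term, so the power [(n * N).+1] has only monomials of degree
    above [n * N], each with some exponent at least [N]. *)
Lemma near_far_power x : x \in M -> exists k y z,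
  [/\ x ^+ k = y + z, mon_in (purepow near) y & mon_in (purepow far) z].
Proof.
rewrite originM => x0; exists (n * N).+1; apply: mon_split => m /(origin_powers x0) dm.
have [k mk] : exists k, (N <= m k)%N.
  apply: contrapT => nok; move: dm; rewrite ltnNge => /negP; apply.
  rewrite mdegE -[n in (n * N)%N]card_ord -sum_nat_const; apply: leq_sum => k _.
  by rewrite leqNgt; apply/negP => mk; apply: nok; exists k; exact: ltnW.
have [kv|kv] := boolP ((k == v1) || (k == v2)); apply/orP; [left|right].
  by apply/existsP; exists k; rewrite /near kv.
by apply/existsP; exists k; rewrite /far (negbTE kv).
Qed.

Lemma bad_triple_not_cm : ~ cohen_macaulay_local T.
Proof.
move=> [M' [locM' [d [[_ dimT] [[s [sM' regs sized]] _]]]]].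
have [P chP] := origin_chain; have d2 := dimT 2%N P chP.
have M'E := local_eq_extended loc locM'.
(* Up to units, the first two terms of the regular sequence are images of polynomials; there are two
   since depth equals dimension. *)
have num i : (i < 2)%N -> exists x v v', [/\ x \in M, v * psi x = nth 0 s i,
    v' * v = 1 & psi x = v' * nth 0 s i].
  move=> i2; have si : (i < size s)%N by rewrite sized (leq_trans i2).
  have /sM' := mem_nth 0 si; rewrite M'E => /asboolP[t [x [tM xM ex]]].
  have [v vt] := localizes_unit loc tM.
  exists x, v, (psi t); split=> //; first by rewrite -ex mulrA vt mul1r.
  by rewrite mulrC.
have [a [va [va' [aM ea ua ea']]]] := num 0%N isT.
have [b [vb [vb' [bM eb ub eb']]]] := num 1%N isT.
have [reg _] := regs.
have r1 t : psi a * t = 0 -> t = 0.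
  rewrite ea' -mulrA => e1.
  have sz : (0 < size s)%N by rewrite sized (leq_trans _ d2).
  apply: (@span_nil _ t); have := reg 0%N sz t; rewrite take0; apply.
  suff -> : nth 0 s 0 * t = 0 by exact: ideal_span0.
  by rewrite -[LHS]mul1r -ua [va' * va]mulrC -mulrA e1 mulr0.
have r2 t t' : psi b * t = psi a * t' -> exists t'', t = psi a * t''.
  move=> e1; have sz : (1 < size s)%N by rewrite sized.
  have tk : take 1 s = [:: nth 0 s 0] by case: (s) sz => // ? [].
  have : ideal_span (fun y => y \in take 1 s) (nth 0 s 1 * t).
    rewrite tk; apply/span_consP; exists (vb * va' * t').
    suff -> : nth 0 s 1 * t - vb * va' * t' * nth 0 s 0 = 0 by exact: ideal_span0.
    by apply/eqP; rewrite subr_eq0 -eb -mulrA e1 ea'; apply/eqP; ring.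
  move/(reg 1%N sz); rewrite tk => /span_consP[c /span_nil/eqP]; rewrite subr_eq0 => /eqP->.
  by exists (c * va); rewrite -ea; ring.
have [k [A1 [A2 [aE A1n A2f]]]] := near_far_power aM.
have [k' [B1 [B2 [bE B1n B2f]]]] := near_far_power bM.
have [ra rb] := regular_pair_powers k k' r1 r2; rewrite -!rmorphXn {}aE {}bE !rmorphD /= in ra rb.
have zero x : x \in I2 A G -> psi x = 0.
  move=> xI; apply/(localizes_ker loc); exists 1; last by rewrite mul1r.
  by case: (localizes_prime loc) => -[].
pose E : {mpoly A[n]} := 'X_[e].
have mixed x y : mon_in (purepow near) x -> mon_in (purepow far) y ->
    psi x * psi y * psi E = 0.
  by move=> xn yf; rewrite -!rmorphM; exact/zero/near_far_mem.
(* Products of a near and a far element kill [E], so [B1 + B2] times [A1 * E] equals [A1 + A2] times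
   [B1 * E] in [T]. Regularity yields [r], which glues [E] and 0 as [h1] and [h2] record. *)
have [|r er] := rb (psi A1 * psi E) (psi B1 * psi E).
  transitivity (psi B1 * psi A1 * psi E + psi A1 * psi B2 * psi E); first by ring.
  transitivity (psi A1 * psi B1 * psi E + psi B1 * psi A2 * psi E); last by ring.
  by rewrite (mixed _ _ A1n B2f) (mixed _ _ B1n A2f); ring.
pose x1 : {mpoly A[n]} := 'X_v1 ^+ N; pose xl : {mpoly A[n]} := 'X_l ^+ N.
have x1n : mon_in (purepow near) x1.
  move=> m; rewrite /x1 mpolyXn msuppX inE => /eqP->; apply/existsP; exists v1.
  by rewrite /near eqxx mulmnE mnm1E eqxx mul1n leqnn.
have xlf : mon_in (purepow far) xl.
  move=> m; rewrite /xl mpolyXn msuppX inE => /eqP->; apply/existsP; exists l.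
  by rewrite /far ![l == _]eq_sym (negbTE v1l) (negbTE v2l) mulmnE mnm1E eqxx mul1n leqnn.
have h1 : psi x1 * (psi E - r) = 0.
  apply: ra; transitivity (psi x1 * psi A2 * psi E +
    psi x1 * (psi A1 * psi E - (psi A1 + psi A2) * r)); first by ring.
  by rewrite (mixed _ _ x1n A2f) er subrr mulr0 addr0.
have h2 : psi xl * r = 0.
  apply: ra; transitivity (psi xl * ((psi A1 + psi A2) * r)); first by ring.
  by rewrite -er -[RHS](mixed _ _ A1n xlf); ring.
have [t tM [rho er']] := localizes_surj loc r.
have /(localizes_ker loc)[t1 t1M] : psi (x1 * (t * E - rho)) = 0.
  rewrite rmorphM rmorphB rmorphM -er'; transitivity (psi t * (psi x1 * (psi E - r))); first by ring.
  by rewrite h1 mulr0.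
have /(localizes_ker loc)[t2 t2M] : psi (xl * rho) = 0.
  by rewrite rmorphM -er' mulrCA h2 mulr0.
have idI := localizes_ideal loc.
move=> /(idealrM t1 idI) i2 /(idealrM t2 idI) i1.
pose sg := t1 * t2.
have {i1} /(mem_path2_ideal cliqueG)/mon_inP i1 :
    (sg * t * E - sg * rho) * x1 \in I2 A G.
  suff -> : (sg * t * E - sg * rho) * x1 = t2 * (t1 * (x1 * (t * E - rho))) by [].
  by rewrite /sg; ring.
have {i2} /(mem_path2_ideal cliqueG)/mon_inP i2 : sg * rho * xl \in I2 A G.
  suff -> : sg * rho * xl = t1 * (t2 * (xl * rho)) by [].
  by rewrite /sg; ring.
(* The constant coefficient of [sg * t] is nonzero. Comparing coefficients at X_v1^N times [e]
   identifies it with the coefficient of [sg * rho] at [e], which must vanish in view of X_l^N times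
   [e]. *)
have : sg * t \notin M by rewrite !(notin_mul loc).
rewrite originM unfold_in => /eqP; apply.
have ek k0 : k0 != v1 -> k0 != v2 -> e k0 = 0%N.
  by move=> k1 k2; rewrite eE (negbTE k1) (negbTE k2).
have := i1 (U_(v1) *+ N + e)%MM.
rewrite /x1 mpolyXn mcoeffMX mcoeffB -{2}[e]addm0 mcoeffMX => /(_ _)/eqP.
rewrite subr_eq0 => /(_ _)/eqP->; last first.
  apply: notpath_near => [|k0 kv1 kv2 _]; rewrite mnmDE mulmnE mnm1E.
    by rewrite (negbTE v1l) ek // eq_sym.
  by rewrite ek // eq_sym (negbTE kv1).
have := i2 (U_(l) *+ N + e)%MM; rewrite /xl mpolyXn mcoeffMX; apply.
apply: notpath_far => [||k0 kv1 kv2 kl]; rewrite mnmDE mulmnE mnm1E.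
- by rewrite eq_sym (negbTE v1l) eE eqxx.
- by rewrite eq_sym (negbTE v2l) eE eqxx orbT.
- by rewrite eq_sym (negbTE kl) ek.
Qed.

End NotCohenMacaulay.
End BadTriple.

Lemma cohen_macaulay_ultrametric :
  cohen_macaulay_ideal (I2 A G) -> reverse_ultrametric w.
Proof.
case=> _ cm i j k ij jk ik; rewrite leqNgt; apply/negP; rewrite leq_min => /andP[b1 b2].
have kj : k != j by rewrite eq_sym.
rewrite (w_sym kj) in b2.
have memM x : (x \in contracted origin_quot) = (x \in origin) by exact: mem_origin_quot.
apply: (bad_triple_not_cm ij ik jk b1 b2 (localizes_quot origin_quot) memM).
exact/cm/origin_quot_maximal.
Qed.

End Necessity.

(** * The weight criterion and its restriction to triangles *)

Lemma cohen_macaulay_iff_ultrametric (A : fieldType) (n : nat) (G : wgraph n) :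
  (1 < n)%N -> is_clique G ->
  cohen_macaulay_ideal (I2 A G) <-> reverse_ultrametric (weight G).
Proof.
move=> n1 cliqueG; split; first exact: cohen_macaulay_ultrametric.
exact: ultrametric_cohen_macaulay.
Qed.

Lemma induced_clique (n : nat) (K : wgraph n) (W : {set 'I_n}) :
  is_clique K -> is_clique (induced K W).
Proof. by move=> cK i j ij; apply: cK; rewrite (inj_eq enum_val_inj). Qed.

Local Close Scope quotient_scope.
Local Close Scope ring_scope.

(** Being a reversed ultrametric is a condition on triples of vertices, hence can be tested on the
    induced 3-cliques. *)
Theorem theorem3 (A : fieldType) (n : nat) (hn : (3 <= n)%N)
    (K : wgraph n) (hK : is_clique K) :
  cohen_macaulay_ideal (I2 A K) <->
  (forall W : {set 'I_n}, #|W| = 3 ->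
     cohen_macaulay_ideal (I2 A (induced K W))).
Proof.
rewrite (cohen_macaulay_iff_ultrametric A (ltnW hn) hK).
split=> [ultra W W3|cmW i j k ij jk ik].
  have W1 : (1 < #|W|)%N by rewrite W3.
  apply/(cohen_macaulay_iff_ultrametric A W1 (induced_clique hK)) => i j k ij jk ik.
  by apply: ultra; rewrite (inj_eq enum_val_inj).
pose W := [set i; j; k].
have W3 : #|W| = 3 by rewrite /W setUC cardsU1 cards2 !inE negb_or ij ![k == _]eq_sym ik jk.
have W1 : (1 < #|W|)%N by rewrite W3.
have [iW jW kW] : [/\ i \in W, j \in W & k \in W] by rewrite !inE !eqxx !orbT.
have rk x y : x \in W -> y \in W -> x != y -> enum_rank_in iW x != enum_rank_in iW y.
  move=> xW yW; apply: contra => /eqP/(congr1 enum_val).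
  by rewrite !enum_rankK_in // => ->.
have := cmW W W3; rewrite (cohen_macaulay_iff_ultrametric A W1 (induced_clique hK)).
move=> /(_ _ _ _ (rk i j iW jW ij) (rk j k jW kW jk) (rk i k iW kW ik)).
by rewrite /= !enum_rankK_in.
Qed.
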